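(* There is an absolute constant $C>0$ such that for all integers $n\ge 3$ and all integers $k$ with $0\le k\le n$, writing $N=\binom{n}{2}$, $$C(n,n+k)\le C\binom{N}{n+k}\left(\frac{2}{e}\right)^n\left(\frac{en}{k}\right)^{k/2}.$$
   Context: $C(n,m)$ denotes the number of connected graphs on $n$ labelled vertices with exactly $m$ edges (simple graphs; $C(n,m)=0$ if $m>\binom n2$). By convention $k^k=1$ when $k=0$, so that $(en/k)^{k/2}=1$ when $k=0$. Here $e$ is the base of natural logarithms. *)

(* Defs.v *)
From mathcomp Require Import all_boot.

Set Implicit Arguments.
Unset Strict Implicit.
Unset Printing Implicit Defensive.

(* A simple graph on the labelled vertex set 'I_n is represented by its edge
   set, a set of two-element subsets of 'I_n. *)
Definition simple_graph (n : nat) (E : {set {set 'I_n}}) : bool :=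
  [forall e in E, #|e| == 2].

Definition edge_rel (n : nat) (E : {set {set 'I_n}}) : rel 'I_n :=
  fun u v => [set u; v] \in E.

(* The empty graph (n = 0) counts as connected under this definition. *)
Definition connected_graph (n : nat) (E : {set {set 'I_n}}) : bool :=
  [forall u, forall v, connect (edge_rel E) u v].

Definition num_connected_graphs (n m : nat) : nat :=
  #|[set E : {set {set 'I_n}} |
      [&& simple_graph E, connected_graph E & #|E| == m]]|.

(* Main.v *)
Require Import Defs.
From HB Require Import structures.
From mathcomp Require Import all_boot all_order all_algebra.
From mathcomp Require Import all_classical all_reals all_analysis.
From mathcomp Require Import zify ring lra.

(** Explore a connected graph on n + 1 labelled vertices from a fixed root: keep
    a list of processed vertices, and at each step process the least vertex
    already seen, that is, adjacent to a processed one.  For each of the n other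
    vertices v record the step f v, counted from 0, at which v is first seen.
    Since the exploration never stops early, f is a parking function.  It
    determines the order of processing, the n edges along which vertices are
    discovered, and all the non-edges between v and vertices processed before
    step f v.  Only 'C(n, 2) - \sum f possible edges remain free, a number called
    the area of f.  Hence the number of connected graphs with n + j edges is at
    most the sum of 'C(area f, j) over parking functions f
    ([num_connected_le_parking]), and 'C(a, j) <= x ^ (- j) e ^ (x a) reduces the
    problem to the exponential moments of the area.

    There are (n + 1) ^ (n - 1) parking functions among (n + 1) ^ n functions,
    and this ratio 1 / (n + 1) has to be gained without losing precision in the
    exponent.  Pollak's circular argument does it: the n + 1 rotations of a
    parking function are distinct, and different parking functions have
    different rotations.  Use L of them, with L a small fixed fraction of n.
    Rotating f by i < L into h changes the area into a centred sum over h, with an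
    error of at most n + 1 times the deficit of h, the highest value of
    i - (number of h v below i) for i < L.  Therefore L times the sum over parking
    functions is at most a sum over all functions h ([sum_parking_le]), where the
    values h v are independent and uniform.  By convexity of the exponential, at
    the price of a factor slightly larger than 1 in the exponent, the two terms
    can be treated separately:
    - the centred area is a sum of independent uniform variables, and
      sinh y <= y e ^ (y ^ 2 / 6) bounds its moment generating function by
      e ^ (x ^ 2 (n + 1) ^ 3 / 24) ([sum_expR_centred_area]);
    - the deficit is the maximum of a walk with L steps.  Stopping the walk when it
      first reaches a level and using Jensen's inequality for the rest of it
      ([first_passage_le]) gives sub-Gaussian moments of variance of order L
      ([sum_expR_deficit]), negligible because L is a small fraction of n.
    With T = n + 1 vertices, j = k + 1 and x ^ 2 = 12 j / T ^ 3 this proves that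
    the number of connected graphs with T + k edges is at most a constant times
    T ^ (T - 1/2) (T ^ 3 / (4 k)) ^ (k / 2).  The argument would give any constant
    below 12 / e in place of 4; that 4 is reached means that e ^ q <= 3 for some
    q > 1 ([expR_inv_sqr_le3]).

    Finally this is compared with the right-hand side.  Stirling's bound
    m! <= e sqrt(m) (m / e) ^ m and (1 + k / T) ^ (T + k) <= e ^ (3 k / 2) show
    that the latter is at least a constant times the same expression
    ([rhs_lower]).  The finitely many small T are absorbed by the constant. *)

Set Implicit Arguments.
Unset Strict Implicit.
Unset Printing Implicit Defensive.

Import Order.TTheory GRing.Theory Num.Theory.
Local Open Scope ring_scope.

(** * The exponential and the hyperbolic sine *)

Lemma ler_exprn (R : numDomainType) m (x y : R) :
  0 <= x -> x <= y -> x ^+ m <= y ^+ m.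
Proof.
by move=> x0 xy; exact: (lerXn2r m (x0 : x \in Num.nneg) (le_trans x0 xy : y \in Num.nneg) xy).
Qed.

(** The tangent of the exponential at the barycentre lies below its graph. *)
Lemma expR_convex (R : realType) (t a b : R) : 0 <= t <= 1 ->
  expR (t * a + (1 - t) * b) <= t * expR a + (1 - t) * expR b.
Proof.
move=> /andP[t0 t1]; set m := t * a + (1 - t) * b.
have tangent c : expR m * (1 + (c - m)) <= expR c.
  have -> : expR c = expR m * expR (c - m) by rewrite -expRD; congr expR; ring.
  by rewrite ler_wpM2l ?expR_ge0 // expR_ge1Dx.
have t1' : 0 <= 1 - t by lra.
have := lerD (ler_wpM2l t0 (tangent a)) (ler_wpM2l t1' (tangent b)).
apply: le_trans; rewrite le_eqVlt; apply/orP; left; apply/eqP.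
rewrite /m; ring.
Qed.

Lemma expRN_le (R : realType) (x : R) : 0 <= x -> expR (- x) <= 1 - x + x ^+ 2.
Proof.
move=> x0; rewrite expRN -[leRHS](mulfK (lt0r_neq0 (expR_gt0 x))).
rewrite ler_peMl ?invr_ge0 ?expR_ge0 //.
(* (1 - x + x ^ 2) (1 + x) = 1 + x ^ 3 >= 1. *)
have := expR_ge1Dx x; have : 0 <= 1 - x + x ^+ 2 by nra.
have : 0 <= x ^+ 3 by exact: exprn_ge0.
move: (expR x) => e; nra.
Qed.

Section Calculus.
Variable R : realType.
Implicit Types (x y z : R) (u : R -> R).

Lemma ge0_of_derive_ge0 u u1 :
  (forall x, is_derive x (1:R) u (u1 x)) -> 0 <= u 0 -> (forall x, 0 <= x -> 0 <= u1 x) ->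
  forall x, 0 <= x -> 0 <= u x.
Proof.
move=> du u0 u1_ge0 x x0.
apply: (le_trans u0).
apply: (@ger0_derive1_ndecr R u 0 x); rewrite ?lexx //.
- move=> y; rewrite in_itv /= => /andP[y0 _].
  by rewrite derive1E; have [_ ->] := du y; rewrite u1_ge0 // ltW.
- by apply: derivable_within_continuous => y _; have [] := du y.
Qed.

(** From u'' >= u the function (u' + u) e ^ (- x) is nondecreasing, hence u' + u
    is nonnegative, and then so is the nondecreasing function u e ^ x.  The
    two bounds on sinh by elementary functions below are instances. *)
Lemma ge0_of_second_derive u u1 u2 :
  (forall x, is_derive x (1:R) u (u1 x)) -> (forall x, is_derive x (1:R) u1 (u2 x)) ->
  0 <= u 0 -> 0 <= u1 0 -> (forall x, 0 <= x -> u x <= u2 x) ->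
  forall x, 0 <= x -> 0 <= u x.
Proof.
move=> du du1 u0 u10 le_u.
have expN x : is_derive x (1:R) (fun x => expR (- x)) (- expR (- x)).
  by apply: is_derive_eq; rewrite mulrN1.
have s1 x : 0 <= x -> 0 <= expR (- x) * (u1 x + u x).
  apply: (@ge0_of_derive_ge0 (fun x => expR (- x) * (u1 x + u x))
    (fun x => expR (- x) * (u2 x - u x))).
  - move=> y; apply: is_derive_eq; rewrite /GRing.scale /=; ring.
  - by rewrite oppr0 expR0 mul1r addr_ge0.
  - by move=> y y0; rewrite mulr_ge0 ?expR_ge0 // subr_ge0 le_u.
have s2 x : 0 <= x -> 0 <= expR x * u x.
  apply: (@ge0_of_derive_ge0 (fun x => expR x * u x)
    (fun x => expR x * (u1 x + u x))).
  - move=> y; apply: is_derive_eq; rewrite /GRing.scale /=; ring.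
  - by rewrite expR0 mul1r.
  - move=> y y0; rewrite mulr_ge0 ?expR_ge0 //.
    by have := s1 y y0; rewrite pmulr_rge0 // expR_gt0.
by move=> x x0; have := s2 x x0; rewrite pmulr_rge0 // expR_gt0.
Qed.

(** Twice the hyperbolic sine and cosine, so that no division by 2 appears. *)
Definition sinh2 x : R := expR x - expR (- x).
Definition cosh2 x : R := expR x + expR (- x).

Lemma is_derive_sinh2 x : is_derive x (1:R) sinh2 (cosh2 x).
Proof.
by rewrite /sinh2 /cosh2; apply: is_derive_eq; rewrite mulrN1 opprK.
Qed.

Lemma is_derive_cosh2 x : is_derive x (1:R) cosh2 (sinh2 x).
Proof. by rewrite /sinh2 /cosh2; apply: is_derive_eq; rewrite mulrN1. Qed.

#[local] Existing Instance is_derive_sinh2.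
#[local] Existing Instance is_derive_cosh2.

Lemma sinh2_ge x : 0 <= x -> 2 * x <= sinh2 x.
Proof.
move=> x0; rewrite -subr_ge0; move: x x0.
apply: (@ge0_of_second_derive (fun x => sinh2 x - 2 * x) (fun x => cosh2 x - 2) sinh2).
- by move=> x; apply: is_derive_eq; rewrite /GRing.scale /=; ring.
- by move=> x; apply: is_derive_eq; rewrite subr0.
- by rewrite /sinh2 oppr0; lra.
- by rewrite /cosh2 oppr0 expR0; lra.
- by move=> x x0; lra.
Qed.

Lemma sinh2_ge0 x : 0 <= x -> 0 <= sinh2 x.
Proof. by move=> x0; apply: le_trans (sinh2_ge x0); lra. Qed.

Lemma sinh2_le_mul_cosh2 x : 0 <= x -> sinh2 x <= x * cosh2 x.
Proof.
move=> x0; rewrite -subr_ge0; move: x x0.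
apply: (@ge0_of_derive_ge0 (fun x => x * cosh2 x - sinh2 x) (fun x => x * sinh2 x)).
- by move=> x; apply: is_derive_eq; rewrite /GRing.scale /=; ring.
- by rewrite /sinh2 oppr0; lra.
- by move=> x x0; rewrite mulr_ge0 // sinh2_ge0.
Qed.

(** The constant 6 is optimal, as the expansion of sinh shows; it decides which
    exponential rate is obtained for connected graphs. *)
Lemma sinh2_le x : 0 <= x -> sinh2 x <= 2 * x * expR (x ^+ 2 / 6).
Proof.
move=> x0; rewrite -subr_ge0; move: x x0.
have dg x : is_derive x (1:R) (fun x => expR (x ^+ 2 / 6)) (x / 3 * expR (x ^+ 2 / 6)).
  by apply: is_derive_eq; rewrite /GRing.scale /=; field.
apply: (@ge0_of_second_derive (fun x => 2 * x * expR (x ^+ 2 / 6) - sinh2 x)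
  (fun x => (2 + 2 / 3 * x ^+ 2) * expR (x ^+ 2 / 6) - cosh2 x)
  (fun x => (2 * x + 2 / 9 * x ^+ 3) * expR (x ^+ 2 / 6) - sinh2 x)).
- by move=> x; apply: is_derive_eq; rewrite /GRing.scale /=; field.
- by move=> x; apply: is_derive_eq; rewrite /GRing.scale /=; field.
- by rewrite /sinh2 oppr0; lra.
- by rewrite /cosh2 oppr0 expr0n /= mul0r expR0; lra.
- move=> x x0; rewrite lerD2r ler_wpM2r ?expR_ge0 // lerDl.
  by rewrite mulr_ge0 ?exprn_ge0 //; lra.
Qed.

End Calculus.

(** * Exploring a connected graph *)

Section Exploration.
Local Open Scope nat_scope.
Variable n : nat.
Implicit Types (E : {set {set 'I_n.+1}}) (s : seq 'I_n.+1) (v : 'I_n.+1).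
Implicit Types (P : seq 'I_n.+1 -> pred 'I_n.+1) (f : {ffun 'I_n -> 'I_n.+1}).

(** The rule P says which vertices are available after processing the list s.
    Leaving it as a parameter makes it possible to run the same exploration from
    the adjacency relation of a graph ([seen]) and from the discovery times alone
    ([spot_order]). *)
Definition explore_step P s :=
  if [pick v | (v \notin s) && P s v] is Some v then rcons s v else s.

Definition explore P k := iter k (explore_step P) [::].

Lemma explore_uniq P k : uniq (explore P k).
Proof.
elim: k => //= k IH; rewrite /explore_step.
by case: pickP => [v /andP[vs _]|//]; rewrite rcons_uniq vs.
Qed.

Lemma explore_prefix P k m : k <= m -> prefix (explore P k) (explore P m).
Proof.
move=> /subnKC <-; elim: (m - k) => [|d IH]; first by rewrite addn0 prefix_refl.
rewrite addnS /= /explore_step; case: pickP => // v _.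
exact/(prefix_trans IH)/prefix_rcons.
Qed.

Lemma eq_explore P P' k :
  (forall i, i < k -> P (explore P i) =1 P' (explore P i)) ->
  explore P k = explore P' k.
Proof.
elim: k => //= k IH eqP; rewrite -IH => [|i ik]; last by apply: eqP; exact: ltnW.
rewrite /explore_step (@eq_pick _ _ [pred v | (v \notin explore P k) && P' (explore P k) v]) //.
by move=> v /=; rewrite eqP.
Qed.

Definition seen E s v := (v == ord0) || has (edge_rel E ^~ v) s.

Lemma edge_relC E u v : edge_rel E u v = edge_rel E v u.
Proof. by rewrite /edge_rel finset.setUC. Qed.

(** Were no further vertex available, s would contain the root and be closed
    under adjacency, hence contain everything. *)
Lemma seen_next E s : connected_graph E -> uniq s -> size s < n.+1 ->
  exists v, (v \notin s) && seen E s v.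
Proof.
move=> /forallP conE us szs.
have [rs|rs] := boolP (ord0 \in s); last by exists ord0; rewrite rs /seen eqxx.
apply/existsP; apply: contraT; rewrite negb_exists => /forallP closed_s.
have cl : fingraph.closed (edge_rel E) (mem s).
  apply: intro_closed => [|u v euv us'].
    by apply: sym_connect_sym => u v; exact: edge_relC.
  have := closed_s v; rewrite negb_and negbK => /orP[//|].
  rewrite /seen negb_or => /andP[_ /hasPn/(_ u us')].
  by rewrite euv.
have : #|'I_n.+1| <= size s.
  rewrite -(card_uniqP us); apply/subset_leq_card/fintype.subsetP => v _.
  have h := closed_connect cl (forallP (conE ord0) v).
  by rewrite -[v \in s]h.
by rewrite card_ord leqNgt szs.
Qed.

Lemma size_explore_seen E k : connected_graph E -> k <= n.+1 ->
  size (explore (seen E) k) = k.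
Proof.
move=> conE; elim: k => //= k IH kn; rewrite /explore_step.
case: pickP => [v _|none]; first by rewrite size_rcons IH // ltnW.
have [|v] := seen_next conE (explore_uniq (seen E) k); first by rewrite IH // ltnW.
by rewrite none.
Qed.

Definition visit_order E := explore (seen E) n.+1.

Lemma take_visit_order E k : connected_graph E -> k <= n.+1 ->
  take k (visit_order E) = explore (seen E) k.
Proof.
move=> conE kn; have := explore_prefix (seen E) kn.
by rewrite prefixE size_explore_seen // => /eqP.
Qed.

Lemma size_visit_order E : connected_graph E -> size (visit_order E) = n.+1.
Proof. by move=> conE; exact: size_explore_seen. Qed.

Lemma uniq_visit_order E : uniq (visit_order E).
Proof. exact: explore_uniq. Qed.

Lemma mem_visit_order E v : connected_graph E -> v \in visit_order E.
Proof.
move=> conE; have /card_uniqP us := uniq_visit_order E.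
have : visit_order E =i 'I_n.+1.
  apply/subset_cardP; last exact: subset_predT.
  by rewrite card_ord us size_visit_order.
by move=> ->.
Qed.

Lemma index_visit_order_lt E v : connected_graph E ->
  index v (visit_order E) < n.+1.
Proof. by move=> conE; rewrite -{2}(size_visit_order conE) index_mem mem_visit_order. Qed.

(** The number of vertices processed when v becomes available; the successor is
    there because v is available just after its first neighbour is processed, and
    the root is available from the start. *)
Definition seen_time E v :=
  if v == ord0 then 0 else (find (edge_rel E ^~ v) (visit_order E)).+1.

Lemma seen_timeP E k v : connected_graph E -> k <= n.+1 ->
  seen E (explore (seen E) k) v = (seen_time E v <= k).
Proof.
move=> conE kn; rewrite /seen /seen_time; case: eqP => //= _.
by rewrite -take_visit_order // has_take_leq // size_visit_order.
Qed.

Lemma seen_time_le_index E v : connected_graph E ->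
  seen_time E v <= index v (visit_order E).
Proof.
move=> conE; set k := index v _.
have vx := mem_visit_order v conE.
have kn : k < n.+1 := index_visit_order_lt v conE.
rewrite -seen_timeP //; last exact: ltnW.
have /= := take_visit_order conE kn.
rewrite (take_nth ord0) ?size_visit_order // nth_index // take_visit_order 1?ltnW //.
rewrite /explore_step; case: pickP => [w /andP[_ sw]|_] eqs.
  by have /eqP := eqs; rewrite eqseq_rcons => /andP[_ /eqP->].
by have := congr1 size eqs; rewrite size_rcons => /esym/n_Sn.
Qed.

Lemma index_visit_order_root E : connected_graph E -> index ord0 (visit_order E) = 0.
Proof.
move=> conE; have sz := size_visit_order conE.
have : seen_time E (nth ord0 (visit_order E) 0) <= 0.
  by rewrite (leq_trans (seen_time_le_index _ conE)) // index_uniq ?sz ?uniq_visit_order.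
rewrite /seen_time; case: eqP => // <- _.
by rewrite index_uniq ?sz ?uniq_visit_order.
Qed.

(** Cars w : 'I_n with preferred spots f w.  The bound i ranges up to n, so the
    last spot of 'I_n.+1 is preferred by no car of a parking function; it is there
    to make the spots a cyclic group of order n + 1. *)
Definition parking f := [forall i : 'I_n.+1, i <= #|[set v | f v < i]|].
Definition area f := 'C(n, 2) - \sum_v f v.

(** The non-root vertices are the cars [lift ord0 w]; the predecessor turns the
    discovery time into the position of the discovering vertex. *)
Definition spots E : {ffun 'I_n -> 'I_n.+1} :=
  [ffun w => inord (seen_time E (lift ord0 w)).-1].

Definition spot_time f v := if unlift ord0 v is Some w then (f w).+1 else 0.

Lemma spot_time_spots E : connected_graph E -> spot_time (spots E) =1 seen_time E.
Proof.
move=> conE v; rewrite /spot_time.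
case: unliftP => [w ->|->]; last by rewrite /seen_time eqxx.
have := seen_time_le_index (lift ord0 w) conE.
have := index_visit_order_lt (lift ord0 w) conE.
rewrite ffunE /seen_time eq_sym (negbTE (neq_lift _ _)) /= => h1 h2.
by rewrite inordK //; lia.
Qed.

Definition spot_order f := explore (fun s v => spot_time f v <= size s) n.+1.

(** Availability depends on the discovery times only, so these determine the
    whole order of processing, whichever graph they come from. *)
Lemma spot_order_spots E : connected_graph E -> spot_order (spots E) = visit_order E.
Proof.
move=> conE; apply/esym/eq_explore => i lt_in v.
have le_in := ltnW lt_in.
by rewrite seen_timeP // spot_time_spots // size_explore_seen.
Qed.

Lemma card_index_lt s k : uniq s -> (forall v, v \in s) -> k <= size s ->
  #|[set v | index v s < k]| = k.
Proof.
move=> us all_s ks; rewrite -[RHS](size_takel ks) -(card_uniqP (take_uniq k us)).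
apply: eq_card => v; rewrite inE -[in RHS](nth_index ord0 (all_s v)).
rewrite -{3}(cat_take_drop k s).
case: (ltnP (index v s) k) => ik.
  by rewrite cat_take_drop -(nth_take ord0 ik) mem_nth // size_takel.
rewrite cat_take_drop nth_index //; apply/esym/negbTE/negP => /index_ltn.
lia.
Qed.

Lemma spots_le_index E w : connected_graph E ->
  spots E w < index (lift ord0 w) (visit_order E).
Proof.
move=> conE; have := seen_time_le_index (lift ord0 w) conE.
by rewrite -spot_time_spots // /spot_time liftK.
Qed.

(** A vertex is seen before it is processed, and exactly i of the non-root
    vertices are among the first i + 1 processed ones. *)
Lemma parking_spots E : connected_graph E -> parking (spots E).
Proof.
move=> conE; apply/forallP => i.
have := @card_index_lt (visit_order E) i.+1 (uniq_visit_order E)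
  (fun v => mem_visit_order v conE).
rewrite size_visit_order // ltn_ord => /(_ isT) ci.
set B := [set w | index (lift ord0 w) (visit_order E) < i.+1].
have sub : [set v | index v (visit_order E) < i.+1] \subset ord0 |: (lift ord0 @: B).
  apply/fintype.subsetP => v; rewrite !inE.
  case: (unliftP ord0 v) => [w ->|->]; last by rewrite eqxx.
  by move=> iw; apply/orP; right; apply: imset_f; rewrite inE.
have := subset_leq_card sub; rewrite ci cardsU1 => h.
have := leq_trans h (leq_add (leq_b1 _) (leq_imset_card _ _)).
rewrite add1n ltnS => /leq_trans; apply.
apply/subset_leq_card/fintype.subsetP => w; rewrite !inE => iw.
exact: leq_trans (spots_le_index w conE) iw.
Qed.

Definition parent_edges f :=
  [set [set v; nth ord0 (spot_order f) (spot_time f v).-1] | v in [set~ ord0]].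

(** Pairs (u, v) with u processed before v but not before v was seen: adjacency of
    such u and v has no influence on the exploration. *)
Definition free_pairs f := [set p : 'I_n.+1 * 'I_n.+1 |
  spot_time f p.2 <= index p.1 (spot_order f) < index p.2 (spot_order f)].

Definition free_edges f := [set [set p.1; p.2] | p in free_pairs f].

Lemma seen_edge E v : connected_graph E -> v != ord0 ->
  edge_rel E (nth ord0 (visit_order E) (seen_time E v).-1) v.
Proof.
move=> conE v0; have := seen_time_le_index v conE.
have iv := index_visit_order_lt v conE.
rewrite /seen_time (negbTE v0) /= => fi.
apply: (@nth_find _ ord0 (edge_rel E ^~ v)).
by rewrite has_find size_visit_order // (leq_trans fi) // ltnW.
Qed.

Lemma parent_edges_sub E : connected_graph E -> parent_edges (spots E) \subset E.
Proof.
move=> conE; apply/fintype.subsetP => e /imsetP[v]; rewrite !inE => v0 ->.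
rewrite spot_order_spots // spot_time_spots //.
have := seen_edge conE v0; rewrite edge_relC; exact.
Qed.

Lemma seen_time_gt0 E v : v != ord0 -> 0 < seen_time E v.
Proof. by move=> v0; rewrite /seen_time (negbTE v0). Qed.

Lemma index_parent E v : connected_graph E -> v != ord0 ->
  index (nth ord0 (visit_order E) (seen_time E v).-1) (visit_order E) = (seen_time E v).-1.
Proof.
move=> conE v0; rewrite index_uniq ?uniq_visit_order ?size_visit_order //.
have := seen_time_le_index v conE; have := seen_time_gt0 E v0.
have := index_visit_order_lt v conE.
lia.
Qed.

(** The discovered end of such an edge is the one processed later, so the edge
    determines it. *)
Lemma card_parent_edges E : connected_graph E -> #|parent_edges (spots E)| = n.
Proof.
move=> conE; rewrite card_in_imset; first by rewrite cardsC1 card_ord.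
move=> v w; rewrite !inE => v0 w0.
rewrite spot_order_spots // !spot_time_spots //.
set pv := nth _ _ _; set pw := nth _ _ _ => eqe.
have ipv : index pv (visit_order E) < index v (visit_order E).
  rewrite index_parent //; have := seen_time_le_index v conE.
  by have := seen_time_gt0 E v0; case: (seen_time E v).
have ipw : index pw (visit_order E) < index w (visit_order E).
  rewrite index_parent //; have := seen_time_le_index w conE.
  by have := seen_time_gt0 E w0; case: (seen_time E w).
have := set21 v pv; rewrite eqe !inE => /orP[/eqP//|/eqP vpw].
have := set21 w pw; rewrite -eqe !inE => /orP[/eqP//|/eqP wpv].
by move: ipv; rewrite -wpv ltnNge ltnW // {1}vpw.
Qed.

(** An edge uv with u processed first makes v seen no later than u is processed;
    if that happens exactly then, uv is the edge that discovers v. *)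
Lemma edges_explored E : simple_graph E -> connected_graph E ->
  E :\: parent_edges (spots E) \subset free_edges (spots E).
Proof.
move=> /forallP simE conE; apply/fintype.subsetP => e; rewrite !inE => /andP[eP eE].
have /cards2P[u [v [uv def_e]]] : #|e| == 2 := implyP (simE e) eE.
wlog iuv : u v uv def_e / index u (visit_order E) < index v (visit_order E).
  move=> wl; have [lt|gt|eq] := ltngtP (index u (visit_order E)) (index v (visit_order E)).
  - exact: (wl u v).
  - by apply: (wl v u) => //; [rewrite eq_sym|rewrite finset.setUC].
  - have := congr1 (nth ord0 (visit_order E)) eq.
    by rewrite !nth_index ?mem_visit_order // => uv'; rewrite uv' eqxx in uv.
apply/imsetP; exists (u, v) => //; rewrite inE /=.
rewrite spot_order_spots // spot_time_spots // iuv andbT.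
have v0 : v != ord0.
  by apply: contraTneq iuv => ->; rewrite index_visit_order_root.
have ul : index u (visit_order E) < size (visit_order E).
  by rewrite index_mem mem_visit_order.
have euv : edge_rel E (nth ord0 (visit_order E) (index u (visit_order E))) v.
  by rewrite nth_index ?mem_visit_order // /edge_rel -def_e.
have fle : find (edge_rel E ^~ v) (visit_order E) <= index u (visit_order E).
  by rewrite leqNgt; apply/negP => /(before_find ord0); rewrite euv.
rewrite /seen_time (negbTE v0) ltn_neqAle fle andbT.
apply: contra eP => /eqP fi; apply/imsetP; exists v; first by rewrite !inE.
rewrite spot_order_spots // spot_time_spots // /seen_time (negbTE v0) /= fi.
by rewrite nth_index ?mem_visit_order // def_e finset.setUC.
Qed.

Lemma sum_index s : uniq s -> (forall v, v \in s) -> size s = n.+1 ->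
  \sum_v index v s = 'C(n.+1, 2).
Proof.
move=> us all_s sz; rewrite -bin2_sum.
transitivity (\sum_(v <- s) index v s).
  rewrite [in LHS](eq_bigl (mem s)) ?big_uniq // => v.
  exact/esym/all_s.
rewrite (big_nth ord0) sz; apply: eq_big_nat => i /andP[_ ilt].
by rewrite index_uniq // sz.
Qed.

Lemma sum_spot_time f : \sum_v spot_time f v = \sum_w f w + n.
Proof.
rewrite big_ord_recl {1}/spot_time unlift_none add0n.
transitivity (\sum_w (f w + 1)).
  by apply: eq_bigr => w _; rewrite /spot_time liftK addn1.
by rewrite big_split sum1_card card_ord.
Qed.

(** For fixed v, the free pairs correspond to the steps between the discovery of v
    and its processing; summing over v gives 'C(n.+1, 2) minus the sum of the
    discovery times. *)
Lemma card_free_edges E : connected_graph E ->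
  #|free_edges (spots E)| <= area (spots E).
Proof.
move=> conE; have us := uniq_visit_order E.
have all_s v : v \in visit_order E by exact: mem_visit_order.
have sz := size_visit_order conE.
apply: leq_trans (leq_imset_card _ _) _.
have -> : #|free_pairs (spots E)| =
    \sum_v (index v (visit_order E) - spot_time (spots E) v).
  rewrite -sum1_card (eq_bigl (fun p => xpredT p.2 &&
    (spot_time (spots E) p.2 <= index p.1 (visit_order E)
       < index p.2 (visit_order E)))); last first.
    by move=> p; rewrite inE spot_order_spots.
  rewrite (reindex_inj (h := fun p => (p.2, p.1))); last by move=> [a b] [c d] [-> ->].
  rewrite -(pair_big_dep xpredT (fun v u => spot_time (spots E) v <= index u (visit_order E)
    < index v (visit_order E)) (fun _ _ => 1)) /=.
  apply: eq_bigr => v _; rewrite sum1dep_card.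
  have iv := index_visit_order_lt v conE.
  have tv : spot_time (spots E) v <= index v (visit_order E).
    by rewrite spot_time_spots // seen_time_le_index.
  transitivity (#|[set u | index u (visit_order E) < index v (visit_order E)]|
      - #|[set u | index u (visit_order E) < spot_time (spots E) v]|); last first.
    by rewrite !card_index_lt // sz 1?(leq_trans tv) 1?ltnW.
  rewrite -cardsDS; last first.
    by apply/fintype.subsetP => u; rewrite !inE => /leq_trans; apply.
  by apply: eq_card => u; rewrite !inE -leqNgt.
have : \sum_v (index v (visit_order E) - spot_time (spots E) v) +
       \sum_v spot_time (spots E) v = 'C(n.+1, 2).
  rewrite -big_split -(sum_index us all_s sz); apply: eq_bigr => v _ /=.
  by rewrite subnK // spot_time_spots // seen_time_le_index.
rewrite sum_spot_time binS bin1 /area; lia.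
Qed.

(** Among graphs with the same parking function f, a graph is determined by its
    edges other than the n edges of discovery, which form a set of j free edges. *)
Lemma num_connected_le_parking j :
  num_connected_graphs n.+1 (n + j) <= \sum_(f | parking f) 'C(area f, j).
Proof.
rewrite /num_connected_graphs -sum1_card (partition_big spots parking) /=; last first.
  by move=> E; rewrite inE => /and3P[_ /parking_spots].
apply: leq_sum => f _; rewrite sum1dep_card.
set X := finset _.
have [->|[E0]] := set_0Vmem X; first by rewrite cards0.
rewrite !inE => /andP[/and3P[_ con0 _] /eqP def_f].
apply: (@leq_trans 'C(#|free_edges f|, j)); last first.
  by apply: leq_bin2l; rewrite -def_f card_free_edges.
rewrite -cards_draws.
have injX : {in X &, injective (fun E => E :\: parent_edges f)}.
  move=> E E'; rewrite !inE => /andP[/and3P[_ cE _] /eqP fE] /andP[/and3P[_ cE' _] /eqP fE'] eqD.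
  have PE := parent_edges_sub cE; have PE' := parent_edges_sub cE'.
  rewrite -(setID E (parent_edges f)) -(setID E' (parent_edges f)) eqD.
  by move: PE PE'; rewrite fE fE' => /finset.setIidPr -> /finset.setIidPr ->.
rewrite -(card_in_imset injX); apply/subset_leq_card/fintype.subsetP => F /imsetP[E].
rewrite !inE => /andP[/and3P[sE cE /eqP mE] /eqP fE] ->.
have := edges_explored sE cE; rewrite fE => -> /=.
have := parent_edges_sub cE; have := card_parent_edges cE.
by rewrite fE => cP PE; rewrite cardsDS // mE cP addKn.
Qed.

End Exploration.

Lemma num_connected_le_bin n m : (num_connected_graphs n m <= 'C('C(n, 2), m))%N.
Proof.
have <- : #|[set e : {set 'I_n} | #|e| == 2]| = 'C(n, 2) by rewrite card_draws card_ord.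
rewrite -cards_draws; apply/subset_leq_card/fintype.subsetP => E.
rewrite !inE => /and3P[/forallP sE _ ->]; rewrite andbT.
by apply/fintype.subsetP => e eE; rewrite inE (implyP (sE e)).
Qed.

(** * Parking functions and rotations *)

Lemma natr_bin2 (R : numFieldType) (m : nat) :
  'C(m, 2)%:R = m%:R * (m%:R - 1) / 2 :> R.
Proof.
case: m => [|m]; first by rewrite bin0n mul0r mul0r.
have := mul_bin_diag m.+1 1; rewrite bin1 => /(congr1 (fun k => k%:R : R)).
by rewrite !natrM -(natr1 m) addrK => ->; rewrite mulrC mulKf // pnatr_eq0.
Qed.

Section Shift.
Variable n : nat.
Implicit Types (f g h : {ffun 'I_n -> 'I_n.+1}) (i : 'I_n.+1).

Definition arrivals h (i : nat) := #|[set v | (h v < i)%N]|.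

Lemma arrivalsE h (i : nat) : arrivals h i = (\sum_v (h v < i)%N)%N.
Proof.
rewrite /arrivals -sum1_card big_mkcond /=; apply: eq_bigr => v _.
by rewrite inE; case: ltnP.
Qed.

Lemma parkingP f i : parking f -> (i <= arrivals f i)%N.
Proof. by move=> /forallP/(_ i). Qed.

Lemma sum_ord_gt (m x : nat) : (\sum_(i < m) (x < i)%N = m - x.+1)%N.
Proof.
elim: m => [|m IH]; first by rewrite big_ord0.
by rewrite big_ord_recr IH /=; case: ltnP; lia.
Qed.

(** Summing the parking condition over all i counts n - f v for every car v.
    In particular the subtraction in [area] does not truncate. *)
Lemma parking_sum_le f : parking f -> (\sum_v f v <= 'C(n, 2))%N.
Proof.
move=> pf.
have h1 : (\sum_(i < n.+1) i <= \sum_(i < n.+1) arrivals f i)%N.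
  by apply: leq_sum => i _; exact: parkingP.
have h2 : (\sum_(i < n.+1) arrivals f i + \sum_v f v = n * n)%N.
  rewrite (eq_bigr _ (fun i _ => arrivalsE f i)).
  rewrite exchange_big -big_split /= -[X in (X * n)%N]card_ord -sum_nat_const.
  apply: eq_bigr => v _; rewrite sum_ord_gt; have := ltn_ord (f v); lia.
have h3 : (\sum_(i < n.+1) i = 'C(n.+1, 2))%N by rewrite -bin2_sum big_mkord.
have := mul_bin_diag n 1; rewrite !bin1; move: h1; rewrite h3 binS bin1.
have : (n * n = n * n.-1 + n)%N by case: (n) => // m; lia.
nia.
Qed.

Definition shift i f : {ffun 'I_n -> 'I_n.+1} := [ffun v => f v + i].

(** Wrapping around occurs exactly for the cars that land below i. *)
Lemma shiftE i f v : (shift i f v + n.+1 * (shift i f v < i) = f v + i)%N.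
Proof.
rewrite ffunE /=; have fn := ltn_ord (f v); have in_ := ltn_ord i.
have [lt|ge] := ltnP (f v + i) n.+1.
  have lti : (f v + i < i)%N = false by lia.
  by rewrite modn_small // lti muln0 addn0.
have -> : ((f v + i) %% n.+1 = f v + i - n.+1)%N.
  by rewrite -{1}(subnK ge) modnDr modn_small //; lia.
have -> : (f v + i - n.+1 < i)%N by lia.
by rewrite muln1 subnK.
Qed.

(** If the rotations agree and i < j, then with d = j - i at least d cars of f
    are below d and at least n + 1 - d cars of g are below n + 1 - d.  The latter
    are exactly the cars of f at or above d: this makes n + 1 cars in total. *)
Lemma shift_parking_inj f g i j :
  parking f -> parking g -> shift i f = shift j g -> i = j.
Proof.
wlog lt_ij : f g i j / (i < j)%N.
  move=> wl pf pg sh; apply: val_inj => /=.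
  have [lt|gt|] := ltngtP i j; last by move=> ->.
    by rewrite (wl f g i j lt pf pg sh).
  by rewrite (wl g f j i gt pg pf (esym sh)).
move=> pf pg sh; exfalso.
have jn := ltn_ord j.
have d1 : (j - i < n.+1)%N by lia.
have d2 : (n.+1 - (j - i) < n.+1)%N by lia.
have := parkingP (Ordinal d1) pf; have := parkingP (Ordinal d2) pg.
rewrite /= !arrivalsE.
suff : (\sum_v (g v < n.+1 - (j - i))%N + \sum_v (f v < j - i)%N = n)%N by lia.
rewrite -big_split /= -[RHS]card_ord -sum1_card; apply: eq_bigr => v _.
have := shiftE i f v; have := shiftE j g v; rewrite -sh.
have := ltn_ord (f v); have := ltn_ord (g v).
by case: ltnP => h1; case: ltnP => h2; case: ltnP => h3; case: ltnP => h4 /=; lia.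
Qed.

Variable R : realType.

(** For a parking function this is its area; for uniform h it is centred up to
    a drift of - 1 / 2 for each car. *)
Definition centred_area h : R := \sum_v ((n%:R - 1) / 2 - (h v)%:R).

(** The highest value on i < L of the walk i - arrivals h i, which starts at 0;
    truncated subtraction is harmless for this reason. *)
Definition deficit (L : nat) h := \max_(i < L) (i - arrivals h i)%N.

(** Rotating by i adds i to each of the n values and takes n + 1 away from those
    that wrap around, whose number is [arrivals] at i after the rotation. *)
Lemma area_le_shift f i L : parking f -> (i < L)%N ->
  (area f)%:R <= centred_area (shift i f) + n.+1%:R * (deficit L (shift i f))%:R.
Proof.
move=> pf iL; set h := shift i f.
have sum_h : (\sum_v h v + n.+1 * arrivals h i = \sum_v f v + n * i)%N.
  rewrite arrivalsE big_distrr -big_split /=.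
  under eq_bigr do rewrite shiftE.
  by rewrite big_split /= sum_nat_const card_ord.
have def_h : (i - arrivals h i <= deficit L h)%N.
  by rewrite /deficit (bigD1 (Ordinal iL)) //= leq_maxl.
have sum_f := parking_sum_le pf.
have area_f : (area f)%:R = 'C(n, 2)%:R - (\sum_v f v)%:R :> R by rewrite natrB.
have bin_n := natr_bin2 R n.
have -> : centred_area h = 'C(n, 2)%:R - (\sum_v h v)%:R.
  rewrite /centred_area big_split /= sumr_const card_ord sumrN natr_sum bin_n.
  by rewrite -(mulr_natl (_ / _) n) mulrA.
rewrite area_f.
have : (\sum_v h v)%:R + n.+1%:R * (arrivals h i)%:R =
    (\sum_v f v)%:R + n%:R * i%:R :> R by rewrite -!natrM -!natrD sum_h.
have : i%:R <= (arrivals h i)%:R + (deficit L h)%:R :> R.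
  by rewrite -natrD ler_nat -leq_subLR.
have : 0 <= i%:R :> R by [].
rewrite -natr1; set a := (arrivals h i)%:R; set D := (deficit L h)%:R => i0 aD.
have : 0 <= n%:R :> R by [].
nra.
Qed.

(** The pairs (i, f) with i < L and f parking are sent injectively to functions by
    rotation, and each term on the left is dominated by the term of its image. *)
Lemma sum_parking_le (w : R) L : 0 <= w -> (L <= n.+1)%N ->
  L%:R * (\sum_(f : {ffun 'I_n -> 'I_n.+1} | parking f) expR (w * (area f)%:R)) <=
  \sum_(h : {ffun 'I_n -> 'I_n.+1}) expR (w * (centred_area h + n.+1%:R * (deficit L h)%:R)).
Proof.
move=> w0 Ln; pose Q := [set p : 'I_n.+1 * {ffun 'I_n -> 'I_n.+1} | (p.1 < L)%N && parking p.2].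
pose F h := expR (w * (centred_area h + n.+1%:R * (deficit L h)%:R)).
have injQ : {in Q &, injective (fun p => shift p.1 p.2)}.
  move=> [i f] [j g]; rewrite !inE /= => /andP[_ pf] /andP[_ pg] sh.
  have ij := shift_parking_inj pf pg sh; rewrite -ij in sh *.
  congr pair; apply/ffunP => v.
  by have := congr1 (fun h : {ffun _} => h v) sh; rewrite /shift !ffunE => /addIr.
apply: (@le_trans _ _ (\sum_(h in [set shift p.1 p.2 | p in Q]) F h)); last first.
  by rewrite big_mkcond; apply: ler_sum => h _; case: ifP => // _; exact: expR_ge0.
rewrite big_imset //= (eq_bigl (fun p : 'I_n.+1 * {ffun 'I_n -> 'I_n.+1} =>
    (p.1 < L)%N && parking p.2)); last first.
  by move=> p; rewrite inE.
rewrite -(pair_big (fun i : 'I_n.+1 => (i < L)%N) (@parking n)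
   (fun i f => F (shift i f))) /=.
have -> : L%:R = \sum_(i < n.+1 | (i < L)%N) 1 :> R.
  rewrite (big_ord_narrow Ln) /=.
  by rewrite sumr_const card_ord.
rewrite big_distrl /=; apply: ler_sum => i iL; rewrite mul1r.
by apply: ler_sum => f pf; rewrite ler_expR ler_wpM2l // area_le_shift.
Qed.

End Shift.

(** * A maximal inequality for the deficit *)

Section Maximal.
Variables (n : nat) (R : realType).
Implicit Types (h : {ffun 'I_n -> 'I_n.+1}) (P : pred {ffun 'I_n -> 'I_n.+1}).
Implicit Types (F G : 'I_n.+1 -> R).

(** The information on h that is revealed by the spots below i. *)
Definition past (i : nat) h : {ffun 'I_n -> option 'I_n.+1} :=
  [ffun v => if (h v < i)%N then Some (h v) else None].

Lemma arrivals_past i j h h' : (j <= i)%N -> past i h = past i h' ->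
  arrivals h j = arrivals h' j.
Proof.
move=> ji hh'; rewrite !arrivalsE; apply: eq_bigr => v _.
have := congr1 (fun g : {ffun _} => g v) hh'; rewrite !ffunE.
by case: (ltnP (h v) i) => hv; case: (ltnP (h' v) i) => hv' //; [case=> ->|move=> _; lia].
Qed.

(** Conditioning on the past: the functions with a given past form a product
    set, on which a sum of products is a product of sums.  A car in the past
    contributes the same factor on both sides, and any other car ranges freely
    over the spots from i on. *)
Lemma sum_prod_le_past i P F G :
  (forall h h', past i h = past i h' -> P h = P h') ->
  (forall x, 0 <= G x) -> (forall x : 'I_n.+1, (x < i)%N -> G x = F x) ->
  \sum_(x < n.+1 | (i <= x)%N) G x <= \sum_(x < n.+1 | (i <= x)%N) F x ->
  \sum_(h | P h) \prod_v G (h v) <= \sum_(h | P h) \prod_v F (h v).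
Proof.
move=> invP G0 GF sumGF.
rewrite (partition_big (past i) predT) // [leRHS](partition_big (past i) predT) //=.
apply: ler_sum => c _.
have [h0 /andP[Ph0 /eqP ch0]|none] := pickP (fun h => P h && (past i h == c)); last first.
  by rewrite !big_pred0.
pose Q v (x : 'I_n.+1) := (if (x < i)%N then Some x else None) == c v.
have fib h : (P h && (past i h == c)) = (h \in family Q).
  apply/andP/familyP => [[_ /eqP ch] v|hQ].
    by rewrite unfold_in /Q -ch ffunE.
  have ch : past i h = c by apply/ffunP => v; rewrite ffunE; apply/eqP/hQ.
  by rewrite ch eqxx (invP h h0) // ch.
rewrite !(eq_bigl _ _ fib) -(bigA_distr_big_dep Q (fun=> G)).
rewrite -(bigA_distr_big_dep Q (fun=> F)).
apply: ler_prod => v _; rewrite sumr_ge0 //=.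
case cv : (c v) => [y|].
  rewrite le_eqVlt; apply/orP; left; apply/eqP; apply: eq_bigr => x.
  by rewrite /Q cv; case: ltnP => // xi _; exact: GF.
suff eqQ x : Q v x = (i <= x)%N by rewrite !(eq_bigl _ _ eqQ).
by rewrite /Q cv; case: ltnP.
Qed.

Lemma sum_ord_ge_if (m i L : nat) (a b : R) :
  \sum_(x < m | (i <= x)%N) (if (x < L)%N then a else b) =
  (minn m L - i)%N%:R * a + (m - maxn i L)%N%:R * b.
Proof.
elim: m => [|m IH].
  by rewrite big_ord0 min0n !sub0n !mul0r addr0.
rewrite big_mkcond big_ord_recr -big_mkcond IH /=.
have [im|mi] := leqP i m; last first.
  have -> : (minn m.+1 L - i = minn m L - i)%N by lia.
  have -> : (m.+1 - maxn i L = m - maxn i L)%N by lia.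
  by rewrite addr0.
have [mL|Lm] := ltnP m L.
  have -> : (minn m.+1 L - i = (m - i).+1)%N by lia.
  have -> : (m.+1 - maxn i L = m - maxn i L)%N by lia.
  rewrite -natr1; ring.
have -> : (minn m.+1 L - i = L - i)%N by lia.
have -> : (m.+1 - maxn i L = (m - maxn i L).+1)%N by lia.
rewrite -natr1; ring.
Qed.

Lemma prod_if_lt (L : nat) (a b : R) h :
  \prod_v (if (h v < L)%N then a else b) =
  a ^+ (arrivals h L) * b ^+ (n - arrivals h L).
Proof.
rewrite (bigID (fun v => (h v < L)%N)) /=; congr (_ * _).
  rewrite (eq_bigr (fun=> a)) => [|v ->//].
  rewrite prodr_const; congr (_ ^+ _); apply: eq_card => v; by rewrite !inE.
rewrite (eq_bigr (fun=> b)) => [|v /negbTE ->//].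
rewrite prodr_const; congr (_ ^+ _).
have -> : (n - arrivals h L = #|~: [set v | (h v < L)%N]|)%N.
  by have := cardsC [set v | (h v < L)%N]; rewrite card_ord /arrivals; lia.
by apply: eq_card => v; rewrite !inE.
Qed.

Definition passes (s i : nat) h := (arrivals h i + s <= i)%N.

Definition first_passage (s i : nat) h :=
  passes s i h && [forall j : 'I_i, ~~ passes s j h].

Lemma first_passage_past s i h h' : past i h = past i h' ->
  first_passage s i h = first_passage s i h'.
Proof.
move=> hh'; rewrite /first_passage /passes (arrivals_past (leqnn i) hh').
congr (_ && _); apply: eq_forallb => j.
by rewrite (arrivals_past (ltnW (ltn_ord j)) hh').
Qed.

(** Given that level s is first reached at i, the n - N remaining cars are uniform
    on the spots from i on, where N <= i - s is the number of arrivals.  Each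
    arrives before L with probability p = (L - i) / (n + 1 - i), and Jensen's
    inequality bounds the conditional expectation of e ^ (x (L - arrivals)) below by
    e ^ (x (L - N - p (n - N))), whose exponent is at least x (1 - p) s.  The
    condition on L ensures p <= 1 / 4. *)
Lemma first_passage_le (x : R) s i L : 0 <= x -> (i < L)%N -> (4 * L <= n.+1)%N ->
  expR (3 / 4 * x * s%:R) * #|[set h | first_passage s i h]|%:R <=
  \sum_(h | first_passage s i h) expR (x * (L%:R - (arrivals h L)%:R)).
Proof.
move=> x0 iL LT.
pose T : R := n.+1%:R.
have LT' : 4 * L%:R <= T by rewrite -natrM ler_nat.
have iL' : i%:R < L%:R :> R by rewrite ltr_nat.
have i0 : 0 <= i%:R :> R by [].
pose p := (L%:R - i%:R) / (T - i%:R).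
have Ti : 0 < T - i%:R by lra.
have pE : p * (T - i%:R) = L%:R - i%:R by rewrite /p divfK // gt_eqF.
have p0 : 0 <= p by rewrite /p divr_ge0 //; lra.
have p4 : p <= 1 / 4 by nra.
have := @sum_prod_le_past i (first_passage s i)
  (fun y => if (y < L)%N then expR (- x) else 1)
  (fun y => if (y < i)%N then expR (- x) else expR (- (p * x))).
move=> /(_ (@first_passage_past s i)) main.
have {main} : \sum_(h | first_passage s i h)
    expR (- x) ^+ arrivals h i * expR (- (p * x)) ^+ (n - arrivals h i) <=
  \sum_(h | first_passage s i h) expR (- x) ^+ arrivals h L.
  rewrite -(eq_bigr _ (fun h _ => prod_if_lt i _ _ h)).
  rewrite [leRHS](eq_bigr (fun h => \prod_v (if (h v < L)%N then expR (- x) else 1))).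
    2: by move=> h _; rewrite prod_if_lt expr1n mulr1.
  apply: main.
  - by move=> y; case: ifP => _; exact: expR_ge0.
  - by move=> y yi; rewrite yi (ltn_trans yi iL).
  rewrite !sum_ord_ge_if.
  have -> : (minn n.+1 i - i = 0)%N by lia.
  have -> : (n.+1 - maxn i i = n.+1 - i)%N by lia.
  have -> : (minn n.+1 L - i = L - i)%N by lia.
  have -> : (n.+1 - maxn i L = n.+1 - L)%N by lia.
  rewrite mul0r add0r mulr1 !natrB; try lia.
  have p01 : 0 <= p <= 1 by lra.
  have := @expR_convex R p (- x) 0 p01.
  rewrite mulr0 addr0 mulrN expR0 mulr1 => cvx.
  have := ler_wpM2l (ltW Ti) cvx; rewrite -/T => /le_trans; apply.
  by rewrite -pE; lra.
have card_sum : \sum_(h | first_passage s i h) expR (3 / 4 * x * s%:R) =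
   expR (3 / 4 * x * s%:R) * #|[set h | first_passage s i h]|%:R.
  rewrite sumr_const -[LHS]mulr_natr; congr (_ * _%:R).
  by apply: eq_card => h; rewrite !inE.
move=> main; rewrite -card_sum.
have expL : 0 <= expR (x * L%:R) by exact: expR_ge0.
have := ler_wpM2l expL main; rewrite !big_distrr /= => main'.
apply: (@le_trans _ _ (\sum_(h | first_passage s i h) expR (x * L%:R) *
   (expR (- x) ^+ arrivals h i * expR (- (p * x)) ^+ (n - arrivals h i)))).
  apply: ler_sum => h /andP[ps _].
  rewrite -!expRM_natl -!expRD ler_expR.
  have Nn : (arrivals h i <= n)%N.
    by rewrite -[X in (_ <= X)%N]card_ord /arrivals max_card.
  rewrite natrB //.
  have : (arrivals h i)%:R + s%:R <= i%:R :> R by rewrite -natrD ler_nat.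
  have nT : n%:R = T - 1 by rewrite /T -natr1 addrK.
  rewrite nT; move: (arrivals h i)%:R => N Ns.
  have s0 : 0 <= s%:R :> R by [].
  move: s0 Ns; move: (s%:R : R) => q q0 Nq.
  suff : 3 / 4 * q <= L%:R - N - (T - 1 - N) * p by nra.
  nra.
apply: le_trans main' _; rewrite le_eqVlt; apply/orP; left; apply/eqP.
apply: eq_bigr => h _; rewrite -!expRM_natl -expRD; congr expR; ring.
Qed.

End Maximal.
Section MaximalInequality.
Variables (n : nat) (R : realType).
Implicit Types (h : {ffun 'I_n -> 'I_n.+1}).

Lemma first_passage_inj s i j h :
  first_passage s i h -> first_passage s j h -> i = j.
Proof.
move=> /andP[pi /forallP fi] /andP[pj /forallP fj].
have [lt|gt|//] := ltngtP i j.
- by have := fj (Ordinal lt); rewrite pi.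
- by have := fi (Ordinal gt); rewrite pj.
Qed.

Lemma first_passage_ex s L h : (0 < s <= deficit L h)%N ->
  exists i : 'I_L, first_passage s i h.
Proof.
move=> /andP[s0 sD].
have [i0 pi0] : exists i : 'I_L, passes s i h.
  apply/existsP; apply: contraLR sD; rewrite negb_exists => /forallP npass.
  rewrite -ltnNge -[s]prednK // ltnS; apply/bigmax_leqP => i _.
  by have := npass i; rewrite /passes; lia.
case: (ex_minnP (ex_intro (fun i => passes s i h) (val i0) pi0)) => i pi mini.
have iL : (i < L)%N by exact: leq_ltn_trans (mini _ pi0) (ltn_ord i0).
exists (Ordinal iL); rewrite /first_passage pi; apply/forallP => j.
by apply/negP => /mini; rewrite leqNgt ltn_ord.
Qed.

(** Chernoff's bound for the maximum of the walk, with the moment taken at the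
    final time L: the events of first passage at the various i < L are disjoint. *)
Lemma card_deficit_ge (x : R) s L : 0 <= x -> (0 < s)%N -> (4 * L <= n.+1)%N ->
  expR (3 / 4 * x * s%:R) * #|[set h : {ffun 'I_n -> 'I_n.+1} | (s <= deficit L h)%N]|%:R <=
  \sum_(h : {ffun 'I_n -> 'I_n.+1}) expR (x * (L%:R - (arrivals h L)%:R)).
Proof.
move=> x0 s0 LT.
have card_le : (#|[set h : {ffun 'I_n -> 'I_n.+1} | (s <= deficit L h)%N]| <=
    \sum_(i < L) #|[set h : {ffun 'I_n -> 'I_n.+1} | first_passage s i h]|)%N.
  rewrite -sum1_card (eq_bigr (fun i : 'I_L =>
    \sum_(h in [set h : {ffun 'I_n -> 'I_n.+1} | first_passage s i h]) 1)%N);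
    last by move=> i _; rewrite sum1_card.
  rewrite (exchange_big_dep xpredT) //= big_mkcond /=.
  apply: leq_sum => h _; rewrite inE; case: ifP => // sD.
  have [|i fi] := @first_passage_ex s L h; first by rewrite s0 sD.
  by rewrite (bigD1 i) ?inE.
have e0 : 0 <= expR (3 / 4 * x * s%:R) by exact: expR_ge0.
move: card_le; rewrite -(ler_nat R) => /(ler_wpM2l e0)/le_trans; apply.
rewrite natr_sum big_distrr /=.
apply: (@le_trans _ _ (\sum_(i < L) \sum_(h : {ffun 'I_n -> 'I_n.+1} | first_passage s i h)
    expR (x * (L%:R - (arrivals h L)%:R)))).
  by apply: ler_sum => i _; exact: first_passage_le.
rewrite (exchange_big_dep xpredT) //=; apply: ler_sum => h _.
have [i fi|none] := pickP (fun i : 'I_L => first_passage s i h).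
  rewrite (big_pred1 i) // => j; apply/idP/eqP => [fj|->//].
  exact/val_inj/(first_passage_inj fj fi).
by rewrite big_pred0 // expR_ge0.
Qed.

Lemma expR_natr_telescope (x : R) d L : (d <= L)%N ->
  expR (x * d%:R) = 1 + \sum_(s < L | (s < d)%N) (expR x - 1) * expR (x * s%:R).
Proof.
move=> dL; rewrite (big_ord_narrow dL) /=; elim: d {dL} => [|d IH].
  by rewrite big_ord0 mulr0 expR0 addr0.
by rewrite big_ord_recr /= addrA -IH -natr1 mulrDr mulr1 expRD; ring.
Qed.

(** Integrate the tail bound of [card_deficit_ge] at the doubled parameter 2 x:
    its decay e ^ (- 3 x s / 2) beats the growth e ^ (x s) of the integrand and
    leaves a geometric series of ratio y = e ^ (- x / 2). *)
Lemma sum_expR_deficit (x : R) L : 0 <= x -> (4 * L <= n.+1)%N ->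
  \sum_(h : {ffun 'I_n -> 'I_n.+1}) expR (x * (deficit L h)%:R) <=
  n.+1%:R ^+ n + 2 * \sum_(h : {ffun 'I_n -> 'I_n.+1}) expR (2 * x * (L%:R - (arrivals h L)%:R)).
Proof.
move=> x0 LT; set B := (X in _ <= _ + 2 * X).
have DL h : (deficit L h <= L)%N.
  apply/bigmax_leqP => i _; exact: leq_trans (leq_subr _ _) (ltnW (ltn_ord i)).
under eq_bigr => h _ do rewrite (expR_natr_telescope x (DL h)).
rewrite big_split /=.
apply: lerD; first by rewrite sumr_const card_ffun !card_ord natrX.
rewrite (exchange_big_dep xpredT) //=.
pose y := expR (- (x / 2)).
have y0 : 0 < y by exact: expR_gt0.
have y1 : y <= 1 by rewrite /y -[leRHS]expR0 ler_expR; lra.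
have B0 : 0 <= B by apply: sumr_ge0 => h _; exact: expR_ge0.
have term (s : 'I_L) : \sum_(h : {ffun 'I_n -> 'I_n.+1} | (s < deficit L h)%N)
    (expR x - 1) * expR (x * s%:R) <= 2 * B * ((1 - y) * y ^+ s).
  rewrite sumr_const -[leLHS]mulr_natr.
  have -> : #|(fun h : {ffun 'I_n -> 'I_n.+1} => (s < deficit L h)%N)| =
     #|[set h : {ffun 'I_n -> 'I_n.+1} | (s.+1 <= deficit L h)%N]|.
    by apply: eq_card => h; rewrite inE.
  have x20 : 0 <= 2 * x by lra.
  have := card_deficit_ge x20 (ltn0Sn s) LT; rewrite -/B.
  set N := #|_|%:R => tail.
  have ex : expR x * y ^+ 2 = 1.
    by rewrite /y -expRM_natl -expRD -[RHS]expR0; congr expR; field.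
  have es : expR (x * s%:R) * y ^+ (2 * s) = 1.
    by rewrite /y -expRM_natl -expRD -[RHS]expR0; congr expR; rewrite natrM; field.
  have e3 : expR (3 / 4 * (2 * x) * s.+1%:R) * y ^+ (3 * s.+1) = 1.
    by rewrite /y -expRM_natl -expRD -[RHS]expR0; congr expR; rewrite natrM; field.
  have {}tail : N <= B * y ^+ (3 * s.+1).
    have yn : 0 <= y ^+ (3 * s.+1) by rewrite exprn_ge0 // ltW.
    by have := ler_wpM2r yn tail; rewrite mulrAC e3 mul1r.
  have e1 : 0 <= (expR x - 1) * expR (x * s%:R).
    by rewrite mulr_ge0 ?expR_ge0 // subr_ge0 -[leLHS]expR0 ler_expR.
  apply: le_trans (ler_wpM2l e1 tail) _.
  have -> : (expR x - 1) * expR (x * s%:R) * (B * y ^+ (3 * s.+1)) =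
    B * (y * (1 + y)) * ((1 - y) * y ^+ s).
    rewrite mulnS exprD (_ : 3 * s = 2 * s + s)%N; last by lia.
    rewrite exprD.
    transitivity (B * (expR x * y ^+ 2 * y - y ^+ 3) * (expR (x * s%:R) * y ^+ (2 * s)) * y ^+ s).
      ring.
    rewrite ex es; ring.
  rewrite ler_wpM2r //; first by rewrite mulr_ge0 ?exprn_ge0 ?subr_ge0 // ltW.
  by rewrite mulrC ler_wpM2r //; nra.
apply: le_trans (ler_sum _ (fun s _ => term s)) _.
rewrite -mulr_sumr -mulr_sumr -[leRHS]mulr1 ler_wpM2l ?mulr_ge0 //.
have <- : 1 - y ^+ L = (1 - y) * \sum_(i < L) y ^+ i.
  have := subrX1 y L; rewrite -opprB => /eqP; rewrite eqr_oppLR => /eqP ->.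
  by rewrite -mulNr opprB.
by rewrite gerBl exprn_ge0 // ltW.
Qed.

(** The number of arrivals before L is binomial with parameters n and
    L / (n + 1). *)
Lemma sum_expR_arrivals (x : R) L : 0 <= x -> (L <= n.+1)%N ->
  \sum_(h : {ffun 'I_n -> 'I_n.+1}) expR (x * (L%:R - (arrivals h L)%:R)) <=
  n.+1%:R ^+ n * expR (x ^+ 2 * L%:R + x * (L%:R / n.+1%:R)).
Proof.
move=> x0 LT; pose T : R := n.+1%:R.
have T0 : 0 < T by rewrite ltr0n.
pose a := L%:R / T.
have a0 : 0 <= a by rewrite divr_ge0 // ltW.
have aT : a * T = L%:R by rewrite /a divfK // gt_eqF.
have e0 := expR_ge0 (- x).
have -> : \sum_(h : {ffun 'I_n -> 'I_n.+1}) expR (x * (L%:R - (arrivals h L)%:R)) =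
   expR (x * L%:R) * (L%:R * expR (- x) + (T - L%:R)) ^+ n.
  transitivity (\sum_(h : {ffun 'I_n -> 'I_n.+1}) expR (x * L%:R) *
     \prod_v (if (h v < L)%N then expR (- x) else 1)).
    apply: eq_bigr => h _; rewrite prod_if_lt expr1n mulr1 -expRM_natl -expRD.
    congr expR; ring.
  rewrite -big_distrr /= -(bigA_distr_bigA (fun (_ : 'I_n) (y : 'I_n.+1) =>
     if (y < L)%N then expR (- x) else 1)) prodr_const card_ord.
  congr (_ * _ ^+ _); rewrite -[LHS]/(\sum_(y < n.+1 | (0 <= y)%N) _) sum_ord_ge_if.
  by rewrite subn0 max0n mulr1 (minn_idPr LT) natrB.
have -> : L%:R * expR (- x) + (T - L%:R) = T * (1 + - (a * (1 - expR (- x)))).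
  by rewrite -aT; ring.
have Tn0 : 0 <= T ^+ n by rewrite exprn_ge0 // ltW.
rewrite exprMn mulrCA; apply: (ler_wpM2l Tn0).
have base0 : 0 <= 1 + - (a * (1 - expR (- x))).
  have a1 : a <= 1 by rewrite /a ler_pdivrMr // mul1r ler_nat.
  by have := expR_ge0 (- x); nra.
have pw := ler_exprn n base0 (expR_ge1Dx _); rewrite -expRM_natl in pw.
apply: le_trans (ler_wpM2l (expR_ge0 _) pw) _.
rewrite -expRD ler_expR -/T -/a.
have nT : n%:R = T - 1 by rewrite /T -natr1 addrK.
have n0 : 0 <= n%:R :> R by [].
have na0 : 0 <= n%:R * a by rewrite mulr_ge0.
have := ler_wpM2l na0 (expRN_le x0); rewrite nT => H.
rewrite -aT.
have : 0 <= a * x ^+ 2 by rewrite mulr_ge0 // exprn_ge0.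
nra.
Qed.

(** The moment generating function of a uniform variable on n + 1 equally spaced
    points is a quotient of hyperbolic sines, up to the factor e ^ (- x / 2) that
    comes from the drift. *)
Lemma sum_expR_centred_area (x : R) : 0 < x ->
  \sum_(h : {ffun 'I_n -> 'I_n.+1}) expR (x * centred_area R h) <=
  n.+1%:R ^+ n * expR (x ^+ 2 * n.+1%:R ^+ 3 / 24).
Proof.
move=> x0; pose T : R := n.+1%:R.
have T0 : 0 < T by rewrite ltr0n.
have nT : n%:R = T - 1 by rewrite /T -natr1 addrK.
have -> : \sum_(h : {ffun 'I_n -> 'I_n.+1}) expR (x * centred_area R h) =
    (\sum_(y < n.+1) expR (x * ((n%:R - 1) / 2 - y%:R))) ^+ n.
  rewrite -[X in _ ^+ X]card_ord -prodr_const bigA_distr_bigA; apply: eq_bigr => h _.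
  by rewrite /centred_area mulr_sumr expR_sum.
pose y := x * T / 2; pose z := x / 2.
have z0 : 0 < z by rewrite divr_gt0.
have y0 : 0 < y by rewrite divr_gt0 // mulr_gt0.
have shz : 0 < sinh2 z by apply: lt_le_trans (sinh2_ge (ltW z0)); lra.
have -> : \sum_(i < n.+1) expR (x * ((n%:R - 1) / 2 - i%:R)) =
    expR (- z) * (sinh2 y / sinh2 z).
  rewrite mulrA; apply/(canRL (mulfK _)); first by rewrite gt_eqF.
  transitivity (expR (y - 2 * z) * (expR z * ((1 - expR (- x)) *
      \sum_(i < n.+1) expR (- x) ^+ i))).
    rewrite mulr_suml !mulr_sumr.
    apply: eq_bigr => i _.
    have -> : x * ((n%:R - 1) / 2 - i%:R) = (y - 2 * z) + i%:R * - x.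
      by rewrite nT /y /z; field.
    rewrite expRD expRM_natl /sinh2.
    have zE : expR z * (1 - expR (- x)) = expR z - expR (- z).
      by rewrite mulrBr mulr1 -expRD; congr (_ - expR _); rewrite /z; field.
    rewrite -zE; ring.
  have -> : (1 - expR (- x)) * \sum_(i < n.+1) expR (- x) ^+ i = 1 - expR (- x) ^+ n.+1.
    have := subrX1 (expR (- x)) n.+1; rewrite -opprB => /eqP; rewrite eqr_oppLR => /eqP ->.
    by rewrite -mulNr opprB.
  rewrite -expRM_natl /sinh2 -/T mulrA -expRD mulrBr mulr1 mulrBr -!expRD.
  by congr (expR _ - expR _); rewrite /y /z; field.
have e1 : expR (- z) <= 1 by rewrite -[leRHS]expR0 ler_expR oppr_le0 ltW.
have sh : sinh2 y / sinh2 z <= T * expR (x ^+ 2 * T ^+ 2 / 24).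
  rewrite ler_pdivrMr //; apply: le_trans (sinh2_le (ltW y0)) _.
  have -> : 2 * y * expR (y ^+ 2 / 6) = T * expR (x ^+ 2 * T ^+ 2 / 24) * (2 * z).
    have -> : y ^+ 2 / 6 = x ^+ 2 * T ^+ 2 / 24 by rewrite /y; field.
    by rewrite /y /z; field.
  by rewrite ler_wpM2l ?sinh2_ge ?ltW // mulr_gt0 // expR_gt0.
have sh0 : 0 <= sinh2 y / sinh2 z by rewrite divr_ge0 ?sinh2_ge0 ?ltW.
apply: (@le_trans _ _ ((T * expR (x ^+ 2 * T ^+ 2 / 24)) ^+ n)).
  have lhs0 : 0 <= expR (- z) * (sinh2 y / sinh2 z) by rewrite mulr_ge0 ?expR_ge0.
  have le1 : expR (- z) * (sinh2 y / sinh2 z) <= T * expR (x ^+ 2 * T ^+ 2 / 24).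
    by apply: le_trans sh; rewrite ler_piMl.
  exact: ler_exprn.
have Tn0 : 0 <= T ^+ n by rewrite exprn_ge0 // ltW.
rewrite exprMn; apply: (ler_wpM2l Tn0).
rewrite -expRM_natl ler_expR -/T nT.
have : 0 <= x ^+ 2 * T ^+ 2 / 24 by rewrite divr_ge0 // mulr_ge0 // exprn_ge0 // ltW.
have -> : x ^+ 2 * T ^+ 3 / 24 = T * (x ^+ 2 * T ^+ 2 / 24) by field.
lra.
Qed.

End MaximalInequality.

(** * An upper bound for the number of connected graphs *)

Section Combine.
Variables (n : nat) (R : realType).
Local Notation T := (n.+1%:R : R).

(** The weights t and 1 - t of the convex combination are free: t close
    to 0 leaves the rate of the centred area almost intact and multiplies the
    parameter of the deficit by the large but constant factor 1 / t. *)
Lemma sum_parking_split (x t : R) L : 0 < x -> 0 < t < 1 -> (4 * L <= n.+1)%N ->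
  L%:R * (\sum_(f : {ffun 'I_n -> 'I_n.+1} | parking f) expR (x * (area f)%:R)) <=
  T ^+ n * (expR ((x / (1 - t)) ^+ 2 * T ^+ 3 / 24) +
   (1 + 2 * expR ((2 * (x * T / t)) ^+ 2 * L%:R + 2 * (x * T / t) * (L%:R / T)))).
Proof.
move=> x0 /andP[t0 t1] LT; have LT1 : (L <= n.+1)%N by lia.
have T0 : 0 < T by rewrite ltr0n.
apply: le_trans (sum_parking_le (ltW x0) LT1) _.
have t1' : 0 < 1 - t by lra.
have t01 : 0 <= t <= 1 by lra.
apply: (@le_trans _ _ (\sum_(h : {ffun 'I_n -> 'I_n.+1})
   (expR (x * T / t * (deficit L h)%:R) + expR (x / (1 - t) * centred_area R h)))).
  apply: ler_sum => h _.
  have -> : x * (centred_area R h + T * (deficit L h)%:R) =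
    t * (x * T / t * (deficit L h)%:R) + (1 - t) * (x / (1 - t) * centred_area R h).
    by field; rewrite !gt_eqF.
  apply: le_trans (expR_convex _ _ t01) _.
  by apply: lerD; rewrite ler_piMl ?expR_ge0 //; lra.
rewrite big_split /= addrC mulrDr; apply: lerD.
  by apply: sum_expR_centred_area; rewrite divr_gt0.
have xT0 : 0 <= x * T / t by rewrite divr_ge0 ?mulr_ge0 // ltW.
apply: le_trans (sum_expR_deficit xT0 LT) _.
rewrite mulrDr mulr1 lerD2l [leRHS]mulrCA ler_wpM2l //.
by apply: sum_expR_arrivals => //; rewrite mulr_ge0.
Qed.

(** One term of the binomial expansion of (1 + x) ^ a. *)
Lemma bin_expR_le (a j : nat) (x : R) : 0 <= x ->
  'C(a, j)%:R * x ^+ j <= expR (x * a%:R).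
Proof.
move=> x0; apply: (@le_trans _ _ ((1 + x) ^+ a)); last first.
  by rewrite expRM_natr; apply: ler_exprn (expR_ge1Dx x); lra.
rewrite exprDn; have [ja|aj] := leqP j a; last first.
  rewrite bin_small // mul0r; apply: sumr_ge0 => i _.
  by rewrite mulrn_wge0 // mulr_ge0 // exprn_ge0.
rewrite -ltnS in ja; rewrite (bigD1 (Ordinal ja)) //= expr1n mul1r mulr_natl lerDl.
by apply: sumr_ge0 => i _; rewrite mulrn_wge0 // mulr_ge0 // exprn_ge0.
Qed.

Lemma num_connected_le_sum_parking (j : nat) (x : R) : 0 < x ->
  (num_connected_graphs n.+1 (n + j))%:R * x ^+ j <=
  \sum_(f : {ffun 'I_n -> 'I_n.+1} | parking f) expR (x * (area f)%:R).
Proof.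
move=> x0; have := num_connected_le_parking n j; rewrite -(ler_nat R) natr_sum.
move=> /(ler_wpM2r (exprn_ge0 j (ltW x0)))/le_trans; apply.
by rewrite mulr_suml; apply: ler_sum => f _; apply: bin_expR_le; exact: ltW.
Qed.

(** Take x ^ 2 = 12 j / T ^ 3, which balances x ^ (- j) against the moment
    e ^ (x ^ 2 T ^ 3 / 24), and L = T / M rounded down, with M so large that the
    deficit contributes at most a constant times the same moment.  The factor
    e ^ (q j / 2) with q = (1 - t) ^ (- 2) then becomes sqrt 3 ^ j. *)
Lemma num_connected_upper (t : R) (M j : nat) : 0 < t < 1 -> 96 <= t ^+ 2 * M%:R ->
  expR ((1 - t) ^- 2) <= 3 -> (M <= n.+1)%N -> (0 < j <= n.+2)%N ->
  (num_connected_graphs n.+1 (n + j))%:R * T <=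
  4 * M%:R * (1 + expR 1) * T ^+ n * Num.sqrt (T ^+ 3 / (4 * j%:R)) ^+ j.
Proof.
move=> t01 tM e3 MT /andP[j0 jn].
have /andP[t0 t1] := t01.
have T0 : 0 < T by rewrite ltr0n.
have J0 : 0 < j%:R :> R by rewrite ltr0n.
have J2T : j%:R <= 2 * T by rewrite -natrM ler_nat; lia.
have M0 : 0 < M%:R :> R by nra.
have T30 : 0 < T ^+ 3 by exact: exprn_gt0.
pose x := Num.sqrt (12 * j%:R / T ^+ 3).
have x2 : x ^+ 2 = 12 * j%:R / T ^+ 3.
  by rewrite sqr_sqrtr // divr_ge0 ?mulr_ge0 // ltW.
have x0 : 0 < x by rewrite sqrtr_gt0 divr_gt0 // mulr_gt0.
set rho := Num.sqrt (T ^+ 3 / _).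
have rho2 : rho ^+ 2 = T ^+ 3 / (4 * j%:R).
  by rewrite sqr_sqrtr // divr_ge0 ?mulr_ge0 // ltW.
have rho0 : 0 <= rho by exact: sqrtr_ge0.
pose L := (n.+1 %/ M)%N.
have L0 : (0 < L)%N by rewrite divn_gt0 // -(ltr0n R).
have LM : (L * M <= n.+1)%N by exact: leq_trunc_div.
have ML : (n.+1 < L.+1 * M)%N by rewrite ltn_ceil // -(ltr0n R).
have LMr : L%:R * M%:R <= T by rewrite -natrM ler_nat.
have MLr : T <= 2 * L%:R * M%:R.
  have L2 : (L.+1 <= 2 * L)%N by rewrite mul2n -addnn -[L.+1]addn1 leq_add2l.
  by rewrite -!natrM ler_nat (leq_trans (ltnW ML)) // leq_mul2r L2 orbT.
have Lr0 : 0 < L%:R :> R by rewrite ltr0n.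
have Lt : 96 * L%:R <= t ^+ 2 * T.
  have : t ^+ 2 * (L%:R * M%:R) <= t ^+ 2 * T by rewrite ler_wpM2l // exprn_ge0 // ltW.
  by nra.
have t2 : t ^+ 2 <= 1 by rewrite expr_le1 // ltW.
have L4 : (4 * L <= n.+1)%N.
  by rewrite -(ler_nat R) natrM; nra.
have := sum_parking_split x0 t01 L4.
set S := \sum_(f : {ffun 'I_n -> 'I_n.+1} | parking f) _ => split.
have eh : expR (j%:R / 2 * (1 - t) ^- 2) <= Num.sqrt 3 ^+ j.
  have -> : j%:R / 2 * (1 - t) ^- 2 = j%:R * ((1 - t) ^- 2 / 2) by ring.
  rewrite expRM_natl.
  have half : expR ((1 - t) ^- 2 / 2) <= Num.sqrt 3.
    rewrite -(@ler_pXn2r _ 2) ?nnegrE ?expR_ge0 ?sqrtr_ge0 //.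
    rewrite sqr_sqrtr // -expRM_natl (le_trans _ e3) // le_eqVlt; apply/orP; left.
    by apply/eqP; congr expR; field; rewrite gt_eqF //; lra.
  exact: ler_exprn (expR_ge0 _) half.
have ex1 : (x / (1 - t)) ^+ 2 * T ^+ 3 / 24 = j%:R / 2 * (1 - t) ^- 2.
  rewrite exprMn x2 exprVn; field.
  by rewrite !gt_eqF //; lra.
have q1 : 1 <= (1 - t) ^- 2.
  by rewrite -exprVn exprn_ege1 // invf_ge1; lra.
(* The exponent of the deficit: 48 j L / (t ^ 2 T) <= j / 2 by the choice of M, and
   the second term is bounded since x T is, j being at most 2 T. *)
have ex2 : (2 * (x * T / t)) ^+ 2 * L%:R + 2 * (x * T / t) * (L%:R / T) <=
    1 + j%:R / 2 * (1 - t) ^- 2.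
  have -> : (2 * (x * T / t)) ^+ 2 * L%:R + 2 * (x * T / t) * (L%:R / T) =
     48 * j%:R * (L%:R / (t ^+ 2 * T)) + 2 * x * L%:R / t.
    rewrite !exprMn x2 exprVn; field.
    by rewrite !gt_eqF //; lra.
  have a1 : L%:R / (t ^+ 2 * T) <= 1 / 96.
    by rewrite ler_pdivrMr ?mulr_gt0 ?exprn_gt0 //; lra.
  have xT : x * T <= 5.
    rewrite -(@ler_pXn2r _ 2) ?nnegrE ?mulr_ge0 ?(ltW x0) // exprMn x2.
    have -> : 12 * j%:R / T ^+ 3 * T ^+ 2 = 12 * j%:R / T by field; rewrite gt_eqF //; lra.
    by rewrite ler_pdivrMr //; nra.
  have a2 : 2 * x * L%:R / t <= 1.
    rewrite ler_pdivrMr // mul1r.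
    have : 96 * (x * L%:R) <= t ^+ 2 * (x * T) by nra.
    by nra.
  have : 48 * j%:R * (L%:R / (t ^+ 2 * T)) <= 48 * j%:R * (1 / 96).
    by rewrite ler_wpM2l // mulr_ge0.
  have : j%:R / 2 <= j%:R / 2 * (1 - t) ^- 2 by rewrite ler_peMr // divr_ge0.
  move: (j%:R / 2 * _) (_ * (L%:R / _)) a2 => u v; lra.
have E1 : 1 <= Num.sqrt (3 : R) ^+ j.
  apply: (le_trans _ eh); rewrite -[leLHS]expR0 ler_expR.
  by apply: mulr_ge0; [exact: divr_ge0|exact: (le_trans ler01 q1)].
have e10 : 0 <= expR (1 : R) := expR_ge0 _.
have tot : expR ((x / (1 - t)) ^+ 2 * T ^+ 3 / 24) +
   (1 + 2 * expR ((2 * (x * T / t)) ^+ 2 * L%:R + 2 * (x * T / t) * (L%:R / T))) <=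
   2 * (1 + expR 1) * Num.sqrt 3 ^+ j.
  have : expR ((2 * (x * T / t)) ^+ 2 * L%:R + 2 * (x * T / t) * (L%:R / T)) <=
     expR 1 * Num.sqrt 3 ^+ j.
    apply: (@le_trans _ _ (expR (1 + j%:R / 2 * (1 - t) ^- 2))); first by rewrite ler_expR.
    by rewrite expRD ler_wpM2l.
  rewrite ex1; nra.
have numS := num_connected_le_sum_parking j x0; rewrite -/S in numS.
have Tn0 : 0 <= T ^+ n by rewrite exprn_ge0 // ltW.
have S0 : 0 <= S by apply: sumr_ge0 => f _; exact: expR_ge0.
have main : T * S <= 4 * M%:R * (1 + expR 1) * T ^+ n * Num.sqrt 3 ^+ j.
  have := ler_wpM2l Tn0 tot; move=> /(le_trans split) LS.
  have := ler_wpM2r S0 MLr => /le_trans; apply.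
  have := ler_wpM2l (ltW M0) LS.
  nra.
have rx : (rho * x) = Num.sqrt 3.
  apply/eqP; rewrite -(@eqrXn2 _ 2) ?mulr_ge0 ?sqrtr_ge0 ?(ltW x0) //.
  rewrite exprMn rho2 x2 sqr_sqrtr //; apply/eqP; field.
  by rewrite !gt_eqF //; lra.
have xj0 : 0 < x ^+ j by exact: exprn_gt0.
rewrite -(ler_pM2r xj0) -[leRHS]mulrA -exprMn rx.
apply: le_trans main; rewrite mulrAC mulrC; by rewrite ler_wpM2l // ltW.
Qed.

End Combine.

(** * Comparison with the binomial bound *)

Section Numerics.
Variable R : realType.

(** This is sinh u <= u cosh u rearranged. *)
Lemma expR_mul2_le (u : R) : 0 <= u < 1 -> expR (2 * u) <= (1 + u) / (1 - u).
Proof.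
move=> /andP[u0 u1]; have := sinh2_le_mul_cosh2 u0; rewrite /sinh2 /cosh2 => H.
rewrite ler_pdivlMr ?subr_gt0 //.
have := expR_gt0 (- u); have : expR (2 * u) * expR (- u) = expR u.
  by rewrite -expRD; congr expR; ring.
move: (expR (2 * u)) (expR u) (expR (- u)) H => a b c H ac c0.
by rewrite -(ler_pM2r c0); nra.
Qed.

(** Stirling's bound, squared to avoid half-integer exponents.  The induction step
    is e ^ 2 <= (1 + 1 / k) ^ (2 k + 1), that is [expR_mul2_le] at
    u = 1 / (2 k + 1), for which (1 + u) / (1 - u) = (k + 1) / k. *)
Lemma fact_sqr_le (m : nat) : (0 < m)%N ->
  (m`!%:R * expR m%:R) ^+ 2 <= expR 1 ^+ 2 * m%:R ^+ (2 * m + 1) :> R.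
Proof.
elim: m => // [[|m]] IH _; first by rewrite mul1r expr1n mulr1.
have {IH} := IH isT; set k := m.+1 => IH.
have k0 : 0 < k%:R :> R by rewrite ltr0n.
have step : expR 1 ^+ 2 * k%:R ^+ (2 * k + 1) <= k.+1%:R ^+ (2 * k + 1) :> R.
  pose u : R := (2 * k%:R + 1)^-1.
  have u0 : 0 < u by rewrite invr_gt0; lra.
  have uE : u * (2 * k%:R + 1) = 1 by rewrite mulVf // gt_eqF //; lra.
  have u1 : u < 1 by nra.
  have u01 : 0 <= u < 1 by rewrite (ltW u0) u1.
  have := expR_mul2_le u01.
  have -> : (1 + u) / (1 - u) = k.+1%:R / k%:R.
    rewrite -natr1; apply/eqP; rewrite eqr_div; last 2 first.
    - by rewrite gt_eqF // subr_gt0.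
    - by rewrite gt_eqF.
    by apply/eqP; nra.
  rewrite ler_pdivlMr // => le1.
  have e0 : 0 <= expR (2 * u) * k%:R by rewrite mulr_ge0 ?expR_ge0 // ltW.
  have H := ler_exprn (2 * k + 1) e0 le1.
  apply: le_trans _ H; rewrite exprMn -!expRM_natl.
  rewrite (_ : (2 * k + 1)%:R * (2 * u) = 2 * 1) // natrD natrM; nra.
have -> : (k.+1)`!%:R * expR k.+1%:R = k.+1%:R * k`!%:R * (expR k%:R * expR 1) :> R.
  by rewrite factS natrM -expRD natr1.
have -> : (k.+1%:R * k`!%:R * (expR k%:R * expR 1)) ^+ 2 =
    k.+1%:R ^+ 2 * expR 1 ^+ 2 * (k`!%:R * expR k%:R) ^+ 2 :> R by ring.
have -> : (2 * k.+1 + 1 = 2 + (2 * k + 1))%N by lia.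
rewrite exprD [leRHS]mulrCA [leRHS]mulrA.
have c0 : 0 <= k.+1%:R ^+ 2 * expR 1 ^+ 2 :> R.
  by rewrite mulr_ge0 ?exprn_ge0 ?expR_ge0.
exact: ler_wpM2l c0 _ _ (le_trans IH step).
Qed.

Lemma fact_le (m : nat) : (0 < m)%N ->
  m`!%:R * expR m%:R <= expR 1 * Num.sqrt m%:R * m%:R ^+ m :> R.
Proof.
move=> m0; rewrite -(@ler_pXn2r _ 2) ?nnegrE ?mulr_ge0 ?expR_ge0 ?exprn_ge0 ?sqrtr_ge0 //.
apply: le_trans (fact_sqr_le m0) _.
by rewrite !exprMn sqr_sqrtr // -exprM -mulrA -exprS mulnC addn1.
Qed.

(** With a = 1 + k / T the claim is a ln a <= 3 (a - 1) / 2 for 1 <= a <= 2.  It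
    follows from ln a <= sinh (ln a) = (a - 1 / a) / 2, which gives
    a ln a <= (a ^ 2 - 1) / 2. *)
Lemma ratio_expn_le (T k : nat) : (0 < T)%N -> (k <= T)%N ->
  (T + k)%:R ^+ (T + k) <= T%:R ^+ (T + k) * expR (3 / 2 * k%:R) :> R.
Proof.
move=> T0 kT; have Tr0 : 0 < T%:R :> R by rewrite ltr0n.
have kTr : k%:R <= T%:R :> R by rewrite ler_nat.
have k0 : 0 <= k%:R :> R by [].
pose a : R := (T + k)%:R / T%:R.
have aT : a * T%:R = T%:R + k%:R by rewrite /a divfK ?gt_eqF // natrD.
have a1 : 1 <= a by nra.
have a0 : 0 < a by lra.
have y0 : 0 <= ln a by rewrite ln_ge0.
have := sinh2_ge y0; rewrite /sinh2 expRN lnK ?posrE // => H.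
have -> : (T + k)%:R = T%:R * a :> R by rewrite mulrC aT natrD.
rewrite exprMn ler_wpM2l ?exprn_ge0 // -{1}(@lnK R a) ?posrE // -expRM_natl ler_expR.
have aV : a * a^-1 = 1 by rewrite mulfV // gt_eqF.
have : a * (2 * ln a) <= a * (a - a^-1) by rewrite ler_wpM2l // ltW.
rewrite mulrBr aV natrD -aT => H2.
have -> : k%:R = (a - 1) * T%:R by lra.
have a2 : a <= 2 by nra.
have : a * ln a <= 3 / 2 * (a - 1) by nra.
by move=> /(ler_wpM2r (ltW Tr0)); lra.
Qed.

Lemma bin_lower (N m : nat) : (m <= N)%N ->
  (N%:R - m%:R) ^+ m <= 'C(N, m)%:R * m`!%:R :> R.
Proof.
move=> mN; rewrite -natrM bin_ffact -natrB // -natrX ler_nat.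
elim: m mN => [//|m IH] mN.
rewrite expnSr ffactnSr leq_mul //; last by lia.
apply: leq_trans (IH (ltnW mN)); case: (m) => // p.
by rewrite leq_exp2r //; lia.
Qed.

Lemma expRN_le_1B (y : R) : 0 <= y <= 1 / 2 -> expR (- (2 * y)) <= 1 - y.
Proof.
move=> /andP[y0 y1]; rewrite expRN -div1r ler_pdivrMr ?expR_gt0 //.
by have := expR_ge1Dx (2 * y); nra.
Qed.

(** With N = 'C(T, 2) and m = T + k, the binomial is at least
    (N - m) ^ m / m!, where N - m >= (T ^ 2 / 2) (1 - 5 / T) loses only the factor
    e ^ 20 since m <= 2 T.  Stirling's bound for m! and [ratio_expn_le] for
    (m / T) ^ m then make all exponential factors cancel, and 4 appears as the
    square of the 2 in T ^ 2 / 2. *)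
Lemma rhs_lower (T k : nat) : (10 <= T)%N -> (k <= T)%N ->
  T%:R ^+ T * Num.sqrt (T%:R ^+ 3 / (4 * k%:R)) ^+ k <=
  expR 21 * Num.sqrt 2 * Num.sqrt T%:R * ('C('C(T, 2), T + k)%:R * (2 / expR 1) ^+ T *
    ((expR 1 * T%:R) / k%:R) `^ (k%:R / 2)) :> R.
Proof.
move=> T10 kT; set m := (T + k)%N; set N := 'C(T, 2).
have Tr : 10 <= T%:R :> R by rewrite ler_nat.
have Tr0 : 0 < T%:R :> R by lra.
have T0 : (0 < T)%N by lia.
have m0 : (0 < m)%N by rewrite /m; lia.
have mr : m%:R <= 2 * T%:R :> R by rewrite -natrM ler_nat /m; lia.
have mr0 : 0 < m%:R :> R by rewrite ltr0n.
have NE : N%:R = T%:R * (T%:R - 1) / 2 :> R by exact: natr_bin2.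
have mN : (m <= N)%N by rewrite -(ler_nat R) NE; nra.
have b1 : (T%:R ^+ 2 / 2) ^+ m * expR (- 20) <= 'C(N, m)%:R * m`!%:R :> R.
  apply: le_trans (bin_lower mN).
  have low : T%:R ^+ 2 / 2 * expR (- (2 * (5 / T%:R))) <= N%:R - m%:R :> R.
    have y01 : 0 <= (5 / T%:R : R) <= 1 / 2.
      by rewrite divr_ge0 ?(ltW Tr0) //= ler_pdivrMr //; lra.
    have c0 : 0 <= T%:R ^+ 2 / 2 :> R by rewrite divr_ge0 // exprn_ge0.
    apply: le_trans (ler_wpM2l c0 (expRN_le_1B y01)) _.
    have -> : T%:R ^+ 2 / 2 * (1 - 5 / T%:R) = T%:R * (T%:R - 1) / 2 - 2 * T%:R :> R.
      by field; rewrite gt_eqF.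
    by rewrite NE; lra.
  have l0 : 0 <= T%:R ^+ 2 / 2 * expR (- (2 * (5 / T%:R))) :> R.
    by rewrite mulr_ge0 ?expR_ge0 // divr_ge0 // exprn_ge0.
  apply: le_trans (ler_exprn m l0 low).
  rewrite [leRHS]exprMn ler_wpM2l ?exprn_ge0 ?divr_ge0 ?exprn_ge0 // -expRM_natl ler_expR.
  have : m%:R / T%:R <= 2 :> R by rewrite ler_pdivrMr.
  lra.
have st := fact_le m0.
have sq : Num.sqrt m%:R <= Num.sqrt 2 * Num.sqrt T%:R :> R.
  by rewrite -sqrtrM // ler_sqrt // mulr_ge0.
have rt := ratio_expn_le T0 kT; rewrite -/m in rt.
set B : R := 'C(N, m)%:R in b1 *.
have B0 : 0 <= B by [].
set s2 := Num.sqrt 2 in sq *; set s := Num.sqrt T%:R in sq *.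
have s20 : 0 <= s2 by exact: sqrtr_ge0.
have s0 : 0 <= s by exact: sqrtr_ge0.
(* Stirling's bound turns b1 into a lower bound for the binomial alone. *)
have b2 : T%:R ^+ m * expR m%:R <= 2 ^+ m * (expR 21 * s2 * s * B * expR (3 / 2 * k%:R)).
  have Tm0 : 0 < T%:R ^+ m :> R by exact: exprn_gt0.
  have em0 : 0 <= expR m%:R :> R by exact: expR_ge0.
  rewrite -(ler_pM2l Tm0).
  have p2 : 0 < 2 ^+ m :> R by exact: exprn_gt0.
  have := ler_wpM2r em0 b1; rewrite expr_div_n -exprM => H1.
  have := ler_wpM2l B0 st => H2.
  have H3 : B * (m`!%:R * expR m%:R) <=
     B * (expR 1 * (s2 * s) * (T%:R ^+ m * expR (3 / 2 * k%:R))).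
    apply: le_trans H2 _; rewrite ler_wpM2l // ler_pM ?mulr_ge0 ?expR_ge0 ?sqrtr_ge0 ?exprn_ge0 //.
    by rewrite ler_wpM2l ?expR_ge0.
  have e20 : expR (- 20) * expR 21 = expR 1 :> R by rewrite -expRD; congr expR; ring.
  have e2121 : expR 20 * expR 1 = expR 21 :> R by rewrite -expRD; congr expR; ring.
  have e2020 : expR (- 20) * expR 20 = 1 :> R by rewrite -expRD -expR0; congr expR; ring.
  have H4 : T%:R ^+ (2 * m) / 2 ^+ m * expR (- 20) * expR m%:R <=
     B * (expR 1 * (s2 * s) * (T%:R ^+ m * expR (3 / 2 * k%:R))).
    by apply: le_trans H1 _; rewrite -[leLHS]mulrA.
  have e20p : 0 <= 2 ^+ m * expR 20 :> R by rewrite mulr_ge0 ?expR_ge0 // ltW.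
  have := ler_wpM2l e20p H4.
  have -> : 2 ^+ m * expR 20 * (T%:R ^+ (2 * m) / 2 ^+ m * expR (- 20) * expR m%:R) =
     T%:R ^+ m * (T%:R ^+ m * expR m%:R) :> R.
    rewrite mul2n -addnn exprD.
    transitivity (T%:R ^+ m * T%:R ^+ m * expR m%:R *
      (expR (- 20) * expR 20) * (2 ^+ m / 2 ^+ m) : R).
      by ring.
    by rewrite e2020 divff ?gt_eqF //; ring.
  move=> /le_trans; apply; rewrite le_eqVlt; apply/orP; left; apply/eqP.
  rewrite -e2121; ring.
set rho := Num.sqrt _; set P := _ `^ _.
have P0 : 0 <= P by exact: powR_ge0.
have rho0 : 0 <= rho by exact: sqrtr_ge0.
have PE : P = Num.sqrt (expR 1 * T%:R / k%:R) ^+ k.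
  have a0 : 0 <= expR 1 * T%:R / k%:R :> R by rewrite divr_ge0 // mulr_ge0 // expR_ge0.
  by rewrite /P (mulrC k%:R) powRrM powR12_sqrt // powR_mulrn ?sqrtr_ge0.
have pk : P * T%:R ^+ k * expR (3 / 2 * k%:R) = 2 ^+ k * expR k%:R ^+ 2 * rho ^+ k.
  have [k0|k0] := posnP k; first by rewrite PE k0 !expr0 mulr0 expR0 expr1n !mulr1.
  have kr0 : 0 < k%:R :> R by rewrite ltr0n.
  have -> : expR k%:R ^+ 2 = (expR 1 ^+ 2) ^+ k :> R.
    by rewrite -!expRM_natl; congr expR; ring.
  have -> : expR (3 / 2 * k%:R) = expR (3 / 2) ^+ k :> R by rewrite expRM_natr.
  rewrite PE -!exprMn; congr (_ ^+ k).
  apply/eqP; rewrite -(@eqrXn2 _ 2) ?mulr_ge0 ?exprn_ge0 ?expR_ge0 ?sqrtr_ge0 //.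
  rewrite !exprMn !sqr_sqrtr ?divr_ge0 ?mulr_ge0 ?exprn_ge0 ?expR_ge0 //.
  have -> : expR (3 / 2) ^+ 2 = expR 1 ^+ 3 :> R.
    by rewrite -!expRM_natl; congr expR; field.
  by apply/eqP; field; rewrite gt_eqF.
have ET : expR m%:R = expR 1 ^+ T * expR k%:R :> R.
  by rewrite -expRM_natl mulr1 -expRD -natrD.
have EE : expR (3 / 2 * k%:R) ^+ 2 = expR k%:R ^+ 3 :> R.
  by rewrite -!expRM_natl; congr expR; field.
have e1p : 0 < expR 1 :> R by exact: expR_gt0.
have Ek : 0 < expR k%:R :> R by exact: expR_gt0.
have Tk0 : 0 < T%:R ^+ k :> R by exact: exprn_gt0.
have eT0 : 0 < expR 1 ^+ T :> R by exact: exprn_gt0.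
have E32 : 0 < expR (3 / 2 * k%:R) :> R by exact: expR_gt0.
have k2 : 0 < 2 ^+ k :> R by exact: exprn_gt0.
have W0 : 0 <= P * expR (3 / 2 * k%:R) by rewrite mulr_ge0 // ltW.
have := ler_wpM2l W0 b2.
have -> : P * expR (3 / 2 * k%:R) * (T%:R ^+ m * expR m%:R) =
    (2 ^+ k * expR k%:R ^+ 3 * expR 1 ^+ T) * (T%:R ^+ T * rho ^+ k) :> R.
  rewrite ET /m exprD.
  transitivity (T%:R ^+ T * expR 1 ^+ T * expR k%:R * (P * T%:R ^+ k * expR (3 / 2 * k%:R))).
    by ring.
  by rewrite pk; ring.
have -> : P * expR (3 / 2 * k%:R) * (2 ^+ m * (expR 21 * s2 * s * B * expR (3 / 2 * k%:R))) =
    (2 ^+ k * expR k%:R ^+ 3 * expR 1 ^+ T) * (expR 21 * s2 * s * (B * (2 / expR 1) ^+ T * P)) :> R.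
  rewrite -EE /m exprD expr_div_n; field; by rewrite gt_eqF.
by rewrite ler_pM2l // !mulr_gt0 // exprn_gt0.
Qed.

(** The left-hand side is about 2.77; the bound comes from
    e ^ (- q) >= (1 - q / 8) ^ 8. *)
Lemma expR_inv_sqr_le3 : expR ((1 - 1 / 100) ^- 2) <= 3 :> R.
Proof.
set q := (1 - 1 / 100) ^- 2.
have qE : q * (99 / 100) ^+ 2 = 1 by rewrite /q; field.
have y_ge : 8724 / 10000 <= 1 + - (q / 8) by nra.
have y0 : 0 <= 1 + - (q / 8) by lra.
have H := ler_exprn 8 y0 (expR_ge1Dx (- (q / 8))).
have : 1 / 3 <= expR (- q).
  have -> : - q = 8%:R * - (q / 8) by field.
  rewrite expRM_natl; apply: (le_trans _ H).
  move: y_ge y0; move: (1 + _) => y y_ge y0.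
  rewrite (exprM y 2 4) (exprM (y ^+ 2) 2 2).
  have y2 : 761 / 1000 <= y ^+ 2 by nra.
  have y4 : 579 / 1000 <= (y ^+ 2) ^+ 2 by nra.
  nra.
rewrite expRN => H3; have := expR_gt0 q => e0.
have : expR q * (expR q)^-1 = 1 by rewrite mulfV // gt_eqF.
by nra.
Qed.

(** Of the k + 1 factors on the left, one is spent on the power of T and the
    others are compared with the factors on the right; for k = 0 the base on the
    right is sqrt (T ^ 3 / 0) = 0, with exponent 0. *)
Lemma sqrt_ratio_succ (T k : nat) : (0 < T)%N ->
  Num.sqrt (T%:R ^+ 3 / (4 * k.+1%:R)) ^+ k.+1 <=
  Num.sqrt (T%:R ^+ 3 / (4 * k%:R)) ^+ k * (T%:R * Num.sqrt T%:R / 2) :> R.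
Proof.
move=> T0; have Tr0 : 0 < T%:R :> R by rewrite ltr0n.
have T30 : 0 <= T%:R ^+ 3 :> R by rewrite exprn_ge0 // ltW.
have last : Num.sqrt (T%:R ^+ 3 / (4 * k.+1%:R)) <= T%:R * Num.sqrt T%:R / 2 :> R.
  rewrite -(@ler_pXn2r _ 2) ?nnegrE ?divr_ge0 ?mulr_ge0 ?sqrtr_ge0 //.
  rewrite !exprMn !sqr_sqrtr ?divr_ge0 ?mulr_ge0 //.
  rewrite ler_pdivrMr ?mulr_gt0 ?ltr0n //.
  have k1 : 1 <= k.+1%:R :> R by rewrite ler1n.
  have -> : T%:R ^+ 2 * T%:R * 2^-1 ^+ 2 * (4 * k.+1%:R) = T%:R ^+ 3 * k.+1%:R :> R.
    by field.
  by rewrite ler_peMr.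
rewrite exprSr ler_pM ?exprn_ge0 ?sqrtr_ge0 //.
have [->|k0] := posnP k; first by rewrite !expr0.
have kr0 : 0 < k%:R :> R by rewrite ltr0n.
have le1 : Num.sqrt (T%:R ^+ 3 / (4 * k.+1%:R)) <= Num.sqrt (T%:R ^+ 3 / (4 * k%:R)) :> R.
  rewrite ler_wsqrtr // ler_wpM2l // lef_pV2 ?posrE ?mulr_gt0 ?ltr0n //.
  by rewrite ler_wpM2l // ler_nat.
exact: ler_exprn (sqrtr_ge0 _) le1.
Qed.

(** [num_connected_upper] at t = 1 / 100 and j = k + 1, against [rhs_lower]. *)
Lemma large_case (M n k : nat) : 96 * 100 ^+ 2 <= M%:R :> R -> (10 <= n)%N -> (M <= n)%N ->
  (k <= n)%N ->
  (num_connected_graphs n (n + k))%:R <= 2 * M%:R * (1 + expR 1) * expR 21 * Num.sqrt 2 *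
    ('C('C(n, 2), n + k)%:R * (2 / expR 1) ^+ n * ((expR 1 * n%:R) / k%:R) `^ (k%:R / 2)) :> R.
Proof.
case: n => // n hM n10 Mn kn; set T := n.+1 in n10 Mn kn *.
have Tr0 : 0 < T%:R :> R by rewrite ltr0n.
have t01 : 0 < (1 / 100 : R) < 1 by apply/andP; split; lra.
have tM : 96 <= (1 / 100) ^+ 2 * M%:R :> R by rewrite expr_div_n expr1n; lra.
have j0 : (0 < k.+1 <= n.+2)%N by [].
have up := num_connected_upper t01 tM expR_inv_sqr_le3 Mn j0.
have low := rhs_lower n10 kn.
set Z := _ `^ _ in low *.
move: low up; rewrite -/T addnS -addSn -/T.
set X := num_connected_graphs _ _; set Q := 'C(_, _)%:R * _ * _.
set rho := Num.sqrt (_ / (4 * k%:R)); set s := Num.sqrt T%:R => low up.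
have s0 : 0 < s by rewrite sqrtr_gt0.
have sT : s ^+ 2 = T%:R by rewrite sqr_sqrtr // ltW.
have A0 : 0 <= 4 * M%:R * (1 + expR 1) * T%:R ^+ n :> R.
  by rewrite !mulr_ge0 ?exprn_ge0 // addr_ge0 ?expR_ge0.
have := ler_wpM2l A0 (sqrt_ratio_succ k (isT : (0 < T)%N)).
move=> /(le_trans up); rewrite -/rho -/s => up2.
have cTs : 0 < T%:R * s by rewrite mulr_gt0.
have D0 : 0 <= 2 * M%:R * (1 + expR 1) :> R.
  by rewrite !mulr_ge0 // addr_ge0 ?expR_ge0.
have low2 := ler_wpM2l D0 low.
have up3 : X%:R * s <= 2 * M%:R * (1 + expR 1) * (T%:R ^+ T * rho ^+ k).
  rewrite -(ler_pM2r cTs).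
  have -> : X%:R * s * (T%:R * s) = X%:R * T%:R * T%:R by rewrite -{3}sT; ring.
  have := ler_wpM2r (ltW Tr0) up2 => /le_trans; apply.
  rewrite le_eqVlt; apply/orP; left; apply/eqP.
  have -> : T%:R ^+ T = T%:R * T%:R ^+ n :> R by rewrite -exprS.
  by field.
rewrite -(ler_pM2r s0); apply: le_trans (le_trans up3 low2) _.
by rewrite le_eqVlt; apply/orP; left; apply/eqP; ring.
Qed.

(** Connected graphs are among all sets of n + k edges, whose number is the
    binomial, and the other two factors have a product of at least e ^ (- n0). *)
Lemma small_case (n0 n k : nat) : (0 < n < n0)%N -> (k <= n)%N ->
  (num_connected_graphs n (n + k))%:R <= expR n0%:R *
    ('C('C(n, 2), n + k)%:R * (2 / expR 1) ^+ n * ((expR 1 * n%:R) / k%:R) `^ (k%:R / 2)) :> R.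
Proof.
move=> /andP[npos nn0] kn.
have e0 : 0 < expR 1 :> R by exact: expR_gt0.
set B : R := 'C(_, _)%:R; have B0 : 0 <= B by [].
have XB : (num_connected_graphs n (n + k))%:R <= B by rewrite ler_nat num_connected_le_bin.
set P := _ `^ _.
have P1 : 1 <= P.
  rewrite /P; have [->|k0] := posnP k; first by rewrite mul0r powRr0.
  have kr0 : 0 < k%:R :> R by rewrite ltr0n.
  have a1 : 1 <= expR 1 * n%:R / k%:R :> R.
    rewrite ler_pdivlMr // mul1r.
    have : k%:R <= n%:R :> R by rewrite ler_nat.
    have : 1 <= expR 1 :> R by rewrite -[leLHS]expR0 ler_expR.
    have : 0 <= n%:R :> R by [].
    nra.
  by rewrite -[leLHS](powRr0 (expR 1 * n%:R / k%:R)) ler_powR // divr_ge0.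
have E1 : 1 <= expR n0%:R * (2 / expR 1) ^+ n :> R.
  rewrite expr_div_n -[expR 1 ^+ n]expRM_natl mulr1 mulrA ler_pdivlMr ?expR_gt0 // mul1r.
  apply: (@le_trans _ _ (expR n0%:R)); first by rewrite ler_expR ler_nat ltnW.
  by rewrite ler_peMr ?expR_ge0 // exprn_ege1 // ler1n.
apply: le_trans XB _.
have -> : expR n0%:R * (B * (2 / expR 1) ^+ n * P) = B * ((expR n0%:R * (2 / expR 1) ^+ n) * P).
  by ring.
rewrite ler_peMr // -[leLHS]mulr1 ler_pM //.
Qed.
End Numerics.

(* For k = 0 the last factor is (_ / 0) `^ 0 = 1 (powRr0), as in the
   convention k ^ k = 1. *)
Theorem proposition1p3 (R : realType) :
  exists C : R, 0 < C /\
    forall n k : nat, (3 <= n)%N -> (k <= n)%N ->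
      (num_connected_graphs n (n + k))%:R <=
        C * 'C('C(n, 2), n + k)%:R * (2 / expR 1) ^+ n
          * ((expR 1 * n%:R) / k%:R) `^ (k%:R / 2).
Proof.
have [M hM] : exists M : nat, 96 * 100 ^+ 2 <= M%:R :> R.
  by exists (96 * 100 ^ 2)%N; rewrite natrM natrX.
(* From 10 vertices on, 1 - 5 / n >= 1 / 2 and enough edges are available in
   rhs_lower; from M on, the window of length n / M is nonempty. *)
pose n0 := maxn 10 M.
pose C1 : R := 2 * M%:R * (1 + expR 1) * expR 21 * Num.sqrt 2.
have C10 : 0 <= C1 by rewrite !mulr_ge0 ?addr_ge0 ?expR_ge0 ?sqrtr_ge0.
exists (C1 + expR n0%:R); split; first by rewrite ltr_wpDl ?expR_gt0.
move=> n k n3 kn; rewrite -2!mulrA [X in _ <= _ * X]mulrA.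
set RHS := _ * _ * _.
have RHS0 : 0 <= RHS.
  by rewrite !mulr_ge0 ?exprn_ge0 ?divr_ge0 ?expR_ge0 ?powR_ge0.
rewrite mulrDl; have [nlt|nge] := ltnP n n0.
  have n_in : (0 < n < n0)%N by rewrite nlt andbT; lia.
  by apply: le_trans (small_case R n_in kn) _; rewrite lerDr mulr_ge0.
have /andP[n10 nM] : (10 <= n)%N && (M <= n)%N by rewrite -geq_max.
by apply: le_trans (large_case hM n10 nM kn) _; rewrite lerDl mulr_ge0 // expR_ge0.
Qed.
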